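(* Let $0<a<b$ and $L>0$. There exists a constant $C>0$, depending only on $a$, $b$ and $L$, such that the following holds. Let $u_0,u_1\in (C_0^\infty(\mathbf{R}^2))^2$ satisfy $\mathrm{supp}\,u_0\cup \mathrm{supp}\,u_1\subset\{|x|\le L\}$, and let $u(t,x)\in\mathbf{R}^2$ be the smooth solution of $$u_{tt}-a^2\Delta u-(b^2-a^2)\nabla\,\mathrm{div}\,u=0,\quad (t,x)\in(0,\infty)\times\mathbf{R}^2,$$ $$u(0,x)=u_0(x),\quad u_t(0,x)=u_1(x),\quad x\in\mathbf{R}^2 .$$ Then, for all sufficiently large $t$, $$\int_{\mathbf{R}^2}|u(t,x)|^2dx\le C\left(\|u_0\|_{L^2}^2+\|u_1\|_{L^\infty}^2+\|u_1\|_{L^1}^2\log(2L+bt)\right).$$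
   Context: For a vector field $u=(u^{(1)},u^{(2)})^T$ on $\mathbf{R}^2$: $|u|^2=|u^{(1)}|^2+|u^{(2)}|^2$, $\Delta u=(\Delta u^{(1)},\Delta u^{(2)})^T$, $\mathrm{div}\,u=\partial_{x_1}u^{(1)}+\partial_{x_2}u^{(2)}$; $\nabla$ and $\mathrm{div}$ act in the space variables only. For a vector field $w$, $\|w\|_{L^p}$ denotes the $L^p(\mathbf{R}^2)$-norm of $|w|$. For such data the Cauchy problem has a unique smooth (classical) solution, and it satisfies the finite propagation speed property $u(t,x)=0$ for $|x|>bt+L$. *)

(* Defs.v *)
From HB Require Import structures.
From mathcomp Require Import all_boot all_order all_algebra.
From mathcomp Require Import all_classical all_reals all_analysis.

Set Implicit Arguments.
Unset Strict Implicit.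
Unset Printing Implicit Defensive.

Import Order.TTheory GRing.Theory Num.Theory.
Import numFieldNormedType.Exports.

Local Open Scope classical_set_scope.
Local Open Scope ring_scope.

Section smoothness.
Context {R : realType} {V W : normedModType R}.

(* ['D_v f] has a default value where the limit does not exist, hence the
   derivability requirement at each order. In finite dimension this is the
   usual class C^n: f and all its iterated directional derivatives up to
   order n exist and are continuous. *)
Fixpoint continuously_derivable (n : nat) (f : V -> W) : Prop :=
  continuous f /\
  match n with
  | 0%N => True
  | m.+1 => forall v : V,
      (forall x, derivable f x v) /\ continuously_derivable m ('D_v f)
  end.

Definition smooth (f : V -> W) : Prop :=
  forall n, continuously_derivable n f.

(* Smoothness up to the boundary on a set A (a closed half-space below):
   f agrees on A with a smooth function on the whole space; the values of f
   outside A are irrelevant. *)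
Definition smooth_on (A : set V) (f : V -> W) : Prop :=
  exists2 g : V -> W, smooth g & {in A, f =1 g}.

Definition supp (f : V -> W) : set V := closure [set x | f x != 0].

Definition test_function (f : V -> W) : Prop := smooth f /\ compact (supp f).

End smoothness.

Section plane.
Context {R : realType}.

(* The norm [`|x|] of the product type R * R is the maximum norm. *)
Definition enorm (x : R * R) : R := Num.sqrt (x.1 ^+ 2 + x.2 ^+ 2).

Definition lebesgue2 :
    {measure set (measurableTypeR R * measurableTypeR R) -> \bar R} :=
  (@lebesgue_measure R \x @lebesgue_measure R)%E.

Definition vLnorm (p : \bar R) (w : R * R -> R * R) : \bar R :=
  Lnorm lebesgue2 p (fun x => (enorm (w x))%:E).

Definition partial1 (f : R * R -> R) : R * R -> R := 'D_((1, 0) : R * R) f.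
Definition partial2 (f : R * R -> R) : R * R -> R := 'D_((0, 1) : R * R) f.

Definition grad (f : R * R -> R) (x : R * R) : R * R :=
  (partial1 f x, partial2 f x).

Definition div (w : R * R -> R * R) (x : R * R) : R :=
  partial1 (fun y => (w y).1) x + partial2 (fun y => (w y).2) x.

Definition laplacian (f : R * R -> R) (x : R * R) : R :=
  partial1 (partial1 f) x + partial2 (partial2 f) x.

Definition vlaplacian (w : R * R -> R * R) (x : R * R) : R * R :=
  (laplacian (fun y => (w y).1) x, laplacian (fun y => (w y).2) x).

(* u is only relevant at times t >= 0, so the initial velocity is the
   one-sided time derivative at 0. *)
Record elastic_wave_solution (a b : R) (u0 u1 : R * R -> R * R)
    (u : R -> R * R -> R * R) : Prop := {
  ews_smooth :
    smooth_on [set z : R * (R * R) | 0 <= z.1] (fun z => u z.1 z.2) ;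
  ews_equation : forall t x, 0 < t ->
    derive1n 2 (fun s => u s x) t - a ^+ 2 *: vlaplacian (u t) x
      - (b ^+ 2 - a ^+ 2) *: grad (div (u t)) x = 0 ;
  ews_position : forall x, u 0 x = u0 x ;
  ews_velocity : forall x,
    h^-1 *: (u h x - u 0 x) @[h --> 0^'+] --> u1 x }.

End plane.

(* Main.v *)
Require Import Defs.
From HB Require Import structures.
From mathcomp Require Import all_boot all_order all_algebra.
From mathcomp Require Import all_classical all_reals all_analysis.
From mathcomp Require Import measurable_realfun lebesgue_integral_under ess_sup_inf ring lra.
Import Order.TTheory GRing.Theory Num.Theory.
Import numFieldNormedType.Exports.
Local Open Scope classical_set_scope.
Local Open Scope ring_scope.
Set Implicit Arguments.
Unset Strict Implicit.
Unset Printing Implicit Defensive.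

(* Integrating in time, v(t) = \int_0^t u solves v_tt + A v = u_1 with
   v(0) = 0, v_t(0) = u_0, where A u = - a^2 Delta u - (b^2 - a^2) grad div u, so
   the energy identity for v reads
     |u|^2 + a^2 |grad v|^2 + (b^2 - a^2) |div v|^2 = |u_0|^2 + 2 (u_1, v)
   in L^2 norms and scalar product.  The last term is absorbed by the gradient
   thanks to a Poincare inequality with logarithmic constant: if v vanishes on
   {x = rho} and w >= 0 lives in a square of size L, then
     \int w |v| <= e |grad v|^2 + C_e (|w|_oo^2 + |w|_1^2 ln (rho / L)).
   For the latter, v is compared along coordinate segments with its values at
   points (s, s k), L <= s <= 2 L, 0 <= k <= 1, and these with v = 0 along the
   rays s -> (s, s k).
   Finite propagation speed, needed to take rho linear in t, follows from the
   same energy computation for v weighted with a cut-off of a shrinking square;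
   a non-sharp speed is enough, since only ln rho enters. *)

(** * Integrals over segments *)

(** In dimension two the L^2 norm of the gradient just fails to control v pointwise; this is where
    the logarithm comes from. It has to multiply the L^1 norm of u_1 alone, and this shapes the
    Poincare inequality. On the coordinate segments, whose lengths are of order L, w is replaced by
    its bound W. Along the rays w enters only through its total mass M, and Young's inequality with
    parameter e s at abscissa s leaves the integral of ds / s. Averaging over the intermediate
    points turns the line integrals of the gradient into area integrals.

    The choice e = a^2 / 4 makes the gradient terms cancel exactly against those of the energy, for
    each component of v; the term with div v is nonnegative and is dropped.

    Squares are used in place of discs, so that the divergence theorem is the fundamental theorem of
    calculus in each variable, and area integrals are iterated integrals of continuous functions. *)

Section interval_integral.
Context {R : realType}.
Implicit Types (a b c d : R) (f g : R -> R).

(** The segment is not oriented: the value is 0 when [b < a]. *)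
Definition itvint a b f : R := \int[lebesgue_measure]_(x in `[a, b]) f x.

Lemma itv_integrable a b f : continuous f ->
  lebesgue_measure.-integrable `[a, b] (EFin \o f).
Proof.
move=> cf; apply: continuous_compact_integrable; first exact: segment_compact.
by apply: continuous_subspaceT.
Qed.

Lemma itvintE a b f : continuous f ->
  (\int[lebesgue_measure]_(x in `[a, b]) (f x)%:E)%E = (itvint a b f)%:E.
Proof.
by move=> cf; rewrite fineK//; apply: integrable_fin_num => //; exact: itv_integrable.
Qed.

Lemma itvint_eq a b f g : (forall x, a <= x <= b -> f x = g x) ->
  itvint a b f = itvint a b g.
Proof.
by move=> fg; apply: eq_Rintegral => x; rewrite inE/= in_itv/= => /fg.
Qed.

Lemma itvintD a b f g : continuous f -> continuous g ->
  itvint a b (fun x => f x + g x) = itvint a b f + itvint a b g.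
Proof. by move=> cf cg; apply: RintegralD => //; exact: itv_integrable. Qed.

Lemma itvintB a b f g : continuous f -> continuous g ->
  itvint a b (fun x => f x - g x) = itvint a b f - itvint a b g.
Proof. by move=> cf cg; apply: RintegralB => //; exact: itv_integrable. Qed.

Lemma itvintZ a b r f : continuous f ->
  itvint a b (fun x => r * f x) = r * itvint a b f.
Proof. by move=> cf; apply: RintegralZl => //; exact: itv_integrable. Qed.

Lemma itvint_cst a b r : a <= b -> itvint a b (fun=> r) = r * (b - a).
Proof.
rewrite /itvint le_eqVlt => /predU1P[->|ab].
  by rewrite set_itv1 Rintegral_set1 subrr mulr0.
by rewrite Rintegral_cst//= lebesgue_measure_itv/= lte_fin ab.
Qed.

Lemma le_itvint a b f g : continuous f -> continuous g ->
  (forall x, a <= x <= b -> f x <= g x) -> itvint a b f <= itvint a b g.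
Proof.
by move=> cf cg fg; apply: le_Rintegral => //; exact: itv_integrable.
Qed.

Lemma itvint_ge0 a b f : (forall x, a <= x <= b -> 0 <= f x) -> 0 <= itvint a b f.
Proof. by move=> f0; apply: Rintegral_ge0 => x /=; rewrite in_itv/= => /f0. Qed.

Lemma itvint_subset a b c d f : continuous f -> (forall x, 0 <= f x) ->
  c <= a -> b <= d -> itvint a b f <= itvint c d f.
Proof.
move=> cf f0 ca bd; rewrite -lee_fin -!itvintE//.
apply: ge0_subset_integral => //=.
- apply/measurable_EFinP; apply: measurable_funTS.
  exact: continuous_measurable_fun.
- by move=> x _; rewrite lee_fin.
- by apply: subset_itv; rewrite bnd_simp.
Qed.

(** Derivatives are asked only inside the segment: the wave equation and the derivatives of
    primitives in time are available for positive times, whereas the integrals start at time 0. *)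
Lemma itvint_FTC2 a b f F : a <= b -> continuous f ->
  (forall x, a <= x <= b -> {for x, continuous F}) ->
  (forall x, a < x < b -> is_derive x 1 F (f x)) ->
  itvint a b f = F b - F a.
Proof.
rewrite le_eqVlt => /predU1P[-> _ _ _|ab cf cF dF].
  by rewrite /itvint set_itv1 Rintegral_set1 subrr.
rewrite /itvint /Rintegral (@continuous_FTC2 R f F)//.
- exact: continuous_subspaceT.
- split.
  + by move=> x /=; rewrite in_itv/= => /dF[].
  + by apply/cvg_at_right_filter/cF; rewrite lexx ltW.
  + by apply/cvg_at_left_filter/cF; rewrite lexx ltW.
- move=> x /=; rewrite in_itv/= => /dF h; rewrite derive1E; exact: derive_val.
Qed.

Lemma itvint_FTC2_closed a b f F : a <= b -> continuous f ->
  (forall x, a <= x <= b -> is_derive x 1 F (f x)) ->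
  itvint a b f = F b - F a.
Proof.
move=> ab cf dF; apply: itvint_FTC2 => // x; last by move=> /andP[? ?]; apply: dF; rewrite !ltW.
by move=> /dF[dFx _]; apply: differentiable_continuous; exact/derivable1_diffP.
Qed.

(** The derivative is two-sided, hence [a < x]; proofs that use it at the left end of a segment
    start the integral one unit earlier. *)
Lemma is_derive_itvint a x f : continuous f -> a < x ->
  is_derive x 1 (fun y => itvint a y f) (f x).
Proof.
move=> cf ax.
have [//||d e] := @continuous_FTC1_closed R f a x (x + 1) _ _ ax (cf x).
- by rewrite ltrDl.
- exact: itv_integrable.
- by apply: (DeriveDef d); rewrite -e derive1E.
Qed.

Lemma normr_itvint_le a b f : continuous f ->
  `|itvint a b f| <= itvint a b (fun x => `|f x|).
Proof.
move=> cf; apply: le_normr_Rintegral => //; exact: itv_integrable.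
Qed.

End interval_integral.

(** * Continuity *)

Section continuity.
Context {T U V : topologicalType}.

Lemma cont_pair (f : T -> U) (g : T -> V) :
  continuous f -> continuous g -> continuous (fun z => (f z, g z)).
Proof. by move=> cf cg z; apply: cvg_pair; [exact: cf|exact: cg]. Qed.

Lemma cont_comp (f : T -> U) (g : U -> V) :
  continuous f -> continuous g -> continuous (fun z => g (f z)).
Proof. by move=> cf cg z; exact: continuous_comp (cf z) (cg _). Qed.

Lemma cont_id : continuous (fun z : T => z).
Proof. by move=> z; exact: cvg_id. Qed.

Lemma cont_cst (a : U) : continuous (fun _ : T => a).
Proof. by move=> z; exact: cvg_cst. Qed.

End continuity.

Section continuity_proj.
Context {T U V : topologicalType}.

Lemma cont_fst (f : T -> U * V) : continuous f -> continuous (fun z => (f z).1).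
Proof. by move=> cf; apply: (cont_comp (g := fst) cf) => z; exact: cvg_fst. Qed.

Lemma cont_snd (f : T -> U * V) : continuous f -> continuous (fun z => (f z).2).
Proof. by move=> cf; apply: (cont_comp (g := snd) cf) => z; exact: cvg_snd. Qed.
End continuity_proj.

Section continuity_real.
Context {R : realType} {T : topologicalType}.
Implicit Types f g h : T -> R.

Lemma contD f g : continuous f -> continuous g -> continuous (fun z => f z + g z).
Proof. by move=> cf cg z; apply: cvgD; [exact: cf|exact: cg]. Qed.
Lemma contN f : continuous f -> continuous (fun z => - f z).
Proof. by move=> cf z; apply: cvgN; exact: cf. Qed.
Lemma contM f g : continuous f -> continuous g -> continuous (fun z => f z * g z).
Proof. by move=> cf cg z; apply: cvgM; [exact: cf|exact: cg]. Qed.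
Lemma contX n f : continuous f -> continuous (fun z => f z ^+ n).
Proof.
move=> cf; elim: n => [|n ih]; first exact: cont_cst.
by under eq_fun do rewrite exprS; exact: contM.
Qed.
Lemma cont_norm f : continuous f -> continuous (fun z => `|f z|).
Proof. by move=> cf z; apply: cvg_norm; exact: cf. Qed.
Lemma cont_max f g : continuous f -> continuous g ->
  continuous (fun z => Num.max (f z) (g z)).
Proof. by move=> cf cg z; apply: continuous_max; [exact: cf|exact: cg]. Qed.
Lemma cont_comp1 (F : R -> R) f : continuous F ->
  continuous f -> continuous (fun z => F (f z)).
Proof. by move=> cF cf; exact: (cont_comp cf). Qed.
Lemma cont_comp2 (F : R -> R -> R) f g : continuous (fun z : R * R => F z.1 z.2) ->
  continuous f -> continuous g -> continuous (fun z => F (f z) (g z)).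
Proof.
move=> cF cf cg.
exact: (@cont_comp _ _ _ (fun z => (f z, g z)) _ (cont_pair cf cg) cF).
Qed.
Lemma cont_comp3 (F : R -> R -> R -> R) f g h :
  continuous (fun z : R * (R * R) => F z.1 z.2.1 z.2.2) ->
  continuous f -> continuous g -> continuous h ->
  continuous (fun z => F (f z) (g z) (h z)).
Proof.
move=> cF cf cg ch.
exact: (@cont_comp _ _ _ (fun z => (f z, (g z, h z))) _
  (cont_pair cf (cont_pair cg ch)) cF).
Qed.
End continuity_real.

Section parametric.
Context {R : realType}.
Implicit Types (a b c d : R).

(** By joint continuity and compactness of the segment, [F z] is uniformly close to [F z0] on it for
    [z] near [z0]. *)
Lemma continuous_itvint {T : topologicalType} a b (F : T -> R -> R) :
  continuous (fun z : T * R => F z.1 z.2) ->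
  continuous (fun z => itvint a b (F z)).
Proof.
move=> cF z0.
have cFz z : continuous (F z).
  exact: (cont_comp (cont_pair (@cont_cst _ T z) (@cont_id R)) cF).
have [ba|ab] := ltP b a.
  rewrite /itvint set_itv_ge -?leNgt ?bnd_simp //.
  under eq_fun do rewrite Rintegral_set0; exact: cvg_cst.
apply/cvgrPdist_le => e e0.
(* The [+ 1] keeps the denominator positive when [a = b]. *)
set d := e / (b - a + 1).
have d0 : 0 < d by rewrite divr_gt0// ltr_pwDr// subr_ge0.
have : \forall z \near z0, `[a, b]%classic `<=` (fun s => `|F z0 s - F z s| <= d).
  apply: (compact_near_coveringP `[a, b]%classic).1 => [|s _].
    exact: segment_compact.
  have /cvgrPdist_le/(_ (d / 2)) h1 := cF (z0, s).
  have /cvgrPdist_le/(_ (d / 2)) h2 := cFz z0 s.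
  have {h1 h2} [h1 h2] : (\forall w \near (z0, s), `|F z0 s - F w.1 w.2| <= d / 2) /\
    (\forall x \near s, `|F z0 s - F z0 x| <= d / 2).
    by split; [apply: h1|apply: h2]; rewrite divr_gt0.
  have h1' : \forall s' \near s & z \near z0, `|F z0 s - F z s'| <= d / 2.
    case: h1 => -[P Q] /= [nP nQ] PQ; exists (Q, P) => //= -[x y] /= [Qx Py].
    exact: (PQ (y, x)).
  have h2' : \forall s' \near s & z \near z0, `|F z0 s - F z0 s'| <= d / 2.
    exists ([set s' | `|F z0 s - F z0 s'| <= d / 2], setT) => /=.
      by split => //; exact: filterT.
    by move=> -[x y] /= [].
  apply: filterS2 h1' h2' => -[s' z] /= h1' h2'.
  have -> : F z0 s' - F z s' = (F z0 s - F z s') - (F z0 s - F z0 s') by ring.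
  by rewrite (le_trans (ler_normB _ _))// [leRHS]splitr lerD.
apply: filterS => z hz.
rewrite -itvintB//.
have cB : continuous (fun s => F z0 s - F z s) by apply: contD => //; exact: contN.
rewrite (le_trans (normr_itvint_le _ _ cB))//.
apply: (@le_trans _ _ (itvint a b (fun=> d))).
  by apply: le_itvint; [exact: cont_norm|exact: cont_cst|move=> x xab; apply: hz; rewrite /= in_itv].
rewrite itvint_cst// -mulrA ger_pMr// mulrC ler_pdivrMr ?mul1r ?lerDl//.
by rewrite ltr_pwDr// subr_ge0.
Qed.
End parametric.

(* Unification eta-reduces [fun z => F a z], hence the cases of partial
   applications. *)
Ltac cont_step := first
  [ match goal with H : continuous ?F |- continuous ?F => exact: H end
  | match goal with
    | |- continuous (fun z => _ + _) => apply: contD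
    | |- continuous (fun z => - _) => apply: contN
    | |- continuous (fun z => _ * _) => apply: contM
    | |- continuous (fun z => _ ^+ _) => apply: contX
    | |- continuous (fun z => `|_|) => apply: cont_norm
    | |- continuous (fun z => Num.max _ _) => apply: cont_max
    | |- continuous (fun z => (_, _)) => apply: cont_pair
    | |- continuous (fun z => z) => apply: cont_id
    end
  | match goal with |- continuous (fun _ => ?a) => exact: (@cont_cst _ _ a) end
  | match goal with
    | H : continuous (fun z => ?F z.1 z.2.1 z.2.2) |- continuous (fun z => ?F _ _ _) =>
      apply: (cont_comp3 H)
    | H : continuous (fun z => ?F z.1 z.2) |- continuous (fun z => ?F _ _) =>
      apply: (cont_comp2 H)
    | H : continuous (fun z => ?F z.1 z.2) |- continuous (?F ?a) =>
      exact: (cont_comp2 H (@cont_cst _ _ a) (@cont_id _))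
    | H : continuous (fun z => ?F z.1 z.2.1 z.2.2) |- continuous (?F ?a ?b) =>
      exact: (cont_comp3 H (@cont_cst _ _ a) (@cont_cst _ _ b) (@cont_id _))
    | H : continuous ?F |- continuous (fun z => ?F _) => apply: (cont_comp1 H)
    end
  | match goal with
    | |- continuous (GRing.mul ?a) =>
      exact: (contM (@cont_cst _ _ a) (@cont_id _))
    | |- continuous fst => apply: (cont_fst (@cont_id _))
    | |- continuous snd => apply: (cont_snd (@cont_id _))
    | |- continuous (fun z => _.1) => apply: cont_fst
    | |- continuous (fun z => _.2) => apply: cont_snd
    end ].
Ltac cont := cbv beta; repeat first [cont_step | apply: continuous_itvint].

(** * Differentiation under the integral sign *)

Section derivatives.
Context {R : realType}.
Implicit Types (f g : R -> R) (x df dg : R).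

Lemma derD f g df dg x : is_derive x 1 f df -> is_derive x 1 g dg ->
  is_derive x 1 (fun z => f z + g z) (df + dg).
Proof. by move=> hf hg; exact: is_deriveD. Qed.

Lemma derN f df x : is_derive x 1 f df -> is_derive x 1 (fun z => - f z) (- df).
Proof. by move=> hf; exact: is_deriveN. Qed.

Lemma derM f g df dg x : is_derive x 1 f df -> is_derive x 1 g dg ->
  is_derive x 1 (fun z => f z * g z) (df * g x + f x * dg).
Proof.
move=> hf hg; apply: (@is_derive_eq _ _ _ _ _ _ _ _ (is_deriveM hf hg)).
by rewrite addrC [df * _]mulrC.
Qed.

Lemma der_id x : is_derive x 1 (fun z => z) 1.
Proof. exact: is_derive_id. Qed.

Lemma der_cst (c x : R) : is_derive x 1 (fun=> c) 0.
Proof. exact: is_derive_cst. Qed.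

Lemma der_comp f g df dg x : is_derive (g x) 1 f df -> is_derive x 1 g dg ->
  is_derive x 1 (fun z => f (g z)) (df * dg).
Proof.
move=> hf hg; apply: (@is_derive_eq _ _ _ _ _ _ _ _ (is_derive1_comp hf hg)).
by [].
Qed.

Lemma der_eq f x df dg : is_derive x 1 f df -> df = dg -> is_derive x 1 f dg.
Proof. by move=> + <-. Qed.

End derivatives.

Section calculus.
Context {R : realType}.
Implicit Types (a b c d : R).

Lemma rectangle_bounded (F : R -> R -> R) a b c d :
  continuous (fun z : R * R => F z.1 z.2) ->
  exists M, forall x y, a <= x <= b -> c <= y <= d -> `|F x y| <= M.
Proof.
move=> cF.
have : compact ((fun z : R * R => F z.1 z.2) @` (`[a, b] `*` `[c, d])).
  apply: continuous_compact; first exact: continuous_subspaceT.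
  by apply: compact_setX; exact: segment_compact.
move=> /compact_bounded [M [_ HM]]; exists (M + 1) => x y xab ycd.
by apply: (HM (M + 1)); [rewrite ltrDl|exists (x, y)]; rewrite //= !in_itv.
Qed.

(** The bound of [F'] on a compact rectangle serves as dominating function. The derivative is asked
    only beyond [u], so that integrals with a variable upper limit qualify as [F]. *)
Lemma is_derive_under_itvint a b (F F' : R -> R -> R) u x : u < x ->
  (forall z, continuous (F z)) -> continuous (fun z : R * R => F' z.1 z.2) ->
  (forall z y : R, u < z -> is_derive z 1 (F^~ y) (F' z y)) ->
  is_derive x 1 (fun z => itvint a b (F z)) (itvint a b (F' x)).
Proof.
move=> ux cF cF' dF.
have p1 z y : u < z -> partial1of2 F z y = F' z y.
  by move=> uz; rewrite partial1of2E; have := dF z y uz => h; apply: derive_val.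
have [M HM] := rectangle_bounded u (x + 1) a b cF'.
have xI : `]u, x + 1[%classic x by rewrite /= in_itv/= ux ltrDl ltr01.
have iF z : `]u, x + 1[%classic z ->
    lebesgue_measure.-integrable `[a, b] (EFin \o F z).
  by move=> _; exact: itv_integrable.
(* [M] may be negative when [[a, b]] is empty, while the dominating function has to be
   nonnegative. *)
have M0 (y : R) : 0 <= Num.max M 0 by rewrite le_max lexx orbT.
have iM : lebesgue_measure.-integrable `[a, b] (EFin \o (fun=> Num.max M 0)).
  by apply: itv_integrable; cont.
have bF z y : `]u, x + 1[%classic z -> `[a, b]%classic y ->
    `|partial1of2 F z y| <= Num.max M 0.
  move=> /=; rewrite !in_itv/= => /andP[z1 z2] yab.
  by rewrite p1// le_max HM// !ltW.
have mI : measurable (`[a, b]%classic : set R) by [].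
have dF' z y : `]u, x + 1[%classic z -> `[a, b]%classic y ->
  derivable (F^~ y) z 1 by rewrite /= in_itv/= => /andP[z1 z2] _; case: (dF z y z1).
have d := @derivable_under_integral R _ _ lebesgue_measure F _ mI x _ _ xI iF dF' _ M0 iM bF.
apply: (DeriveDef d).
rewrite -derive1E (@differentiation_under_integral R _ _ lebesgue_measure F _ mI x _ _ xI iF dF' _ M0 iM bF).
by apply: eq_Rintegral => y _; rewrite p1.
Qed.

Lemma eq_of_derive (F G f : R -> R) a b : a <= b -> continuous f ->
  (forall x, a <= x <= b -> is_derive x 1 F (f x)) ->
  (forall x, a <= x <= b -> is_derive x 1 G (f x)) ->
  F b - F a = G b - G a.
Proof.
by move=> ab cf dF dG; rewrite -(itvint_FTC2_closed ab cf dF) (itvint_FTC2_closed ab cf dG).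
Qed.

Lemma itvint_primitive a b c (f : R -> R) : continuous f -> a < b -> b <= c ->
  itvint b c f = itvint a c f - itvint a b f.
Proof.
move=> cf ab bc; apply: (itvint_FTC2_closed (F := fun y => itvint a y f)) => // x /andP[bx _].
by apply: is_derive_itvint => //; exact: lt_le_trans bx.
Qed.

(** As functions of the upper limit of the outer variable, both sides have the same continuous
    derivative. The integrals start at [a - 1] so that this derivative exists at [a] too. *)
Lemma itvint_swap (F : R -> R -> R) a b c d : a <= b ->
  continuous (fun z : R * R => F z.1 z.2) ->
  itvint a b (fun x => itvint c d (fun y => F x y)) =
  itvint c d (fun y => itvint a b (fun x => F x y)).
Proof.
move=> ab cF; have aa : a - 1 < a by rewrite ltrBlDr ltrDl.
have cL : continuous (fun x => itvint c d (fun y => F x y)).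
  exact: continuous_itvint.
have cR z : continuous (fun y => itvint (a - 1) z (F^~ y)).
  by apply: (continuous_itvint (F := fun y x => F x y)); cont.
rewrite (itvint_primitive cL aa ab).
rewrite [RHS](@itvint_eq _ _ _ _ (fun y =>
  itvint (a - 1) b (F^~ y) - itvint (a - 1) a (F^~ y))); last first.
  by move=> y _; apply: itvint_primitive => //; cont.
rewrite (itvintB _ _ (cR b) (cR a)).
apply: (@eq_of_derive (fun z => itvint (a - 1) z (fun x => itvint c d (fun y => F x y)))
  (fun z => itvint c d (fun y => itvint (a - 1) z (F^~ y)))
  (fun x => itvint c d (fun y => F x y))) => //.
- by move=> x /andP[ax _]; apply: is_derive_itvint => //; exact: lt_le_trans ax.
- move=> x /andP[ax _].
  apply: (@is_derive_under_itvint c d (fun z y => itvint (a - 1) z (F^~ y)) F (a - 1) x) => //.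
    exact: lt_le_trans ax.
  by move=> z y az; apply: is_derive_itvint => //; cont.
Qed.

Lemma itvint_scale (f : R -> R) s : 0 <= s -> continuous f ->
  s * itvint 0 1 (fun x => f (s * x)) = itvint 0 s f.
Proof.
move=> s0 cf; rewrite -itvintZ; last by cont.
have m1 : -1 < 0 :> R by rewrite ltrN10.
rewrite (itvint_primitive cf m1 s0).
rewrite -[X in itvint _ X f]mulr1 -[X in _ - itvint _ X f](mulr0 s).
apply: (itvint_FTC2_closed (F := fun x => itvint (-1) (s * x) f)) => //.
  by cont.
move=> x /andP[x0 _].
have h := is_derive_itvint cf (lt_le_trans m1 (mulr_ge0 s0 x0)).
apply: der_eq (der_comp h (derM (der_cst s x) (der_id x))) _.
by rewrite mul0r add0r mulr1 mulrC.
Qed.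
End calculus.

(** * Differentiation along rays *)

Section rays.
Context {R : realType}.
Implicit Types (a b c d s : R).

(** The difference quotient at [s] is [Q] itself, so continuity of [Q] is what gives the derivative.
    This covers functions factored at a zero: the increment along a ray, and the squared positive
    part at 0. *)
Lemma is_derive_root (Q : R -> R) s : {for s, continuous Q} ->
  is_derive s 1 (fun z => (z - s) * Q z) (Q s).
Proof.
move=> cQ.
have h : h^-1 *: ((h *: 1 + s - s) * Q (h *: 1 + s) - (s - s) * Q s) @[h --> 0^'] --> Q s.
  have : Q (h + s) @[h --> 0^'] --> Q s.
    apply: (cvg_comp (fun h => h + s) Q); last exact: cQ.
    apply: cvg_within_filter.
    have : h + s @[h --> (0 : R)] --> 0 + s by apply: cvgD; [exact: cvg_id|exact: cvg_cst].
    by rewrite add0r.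
  apply: cvg_trans; apply: near_eq_cvg; near=> h.
  rewrite subrr mul0r subr0 addrK /GRing.scale/= mulr1 mulrA mulVf ?mul1r//.
  by near: h; exact: nbhs_dnbhs_neq.
apply: DeriveDef; first by apply/cvg_ex; exists (Q s).
exact: cvg_lim h.
Unshelve. all: by end_near. Qed.

(** A chain rule from partial derivatives: [v z (z * k) - v s (z * k)] is [(z - s) * Q z] with [Q z]
    the mean of [v1] over a horizontal segment, continuous in [z]; the rest depends on [z] through
    the second argument only. *)
Lemma is_derive_ray (v v1 v2 : R -> R -> R) k s :
  continuous (fun z : R * R => v1 z.1 z.2) ->
  (forall x y : R, is_derive x 1 (v^~ y) (v1 x y)) ->
  (forall x y : R, is_derive y 1 (v x) (v2 x y)) ->
  is_derive s 1 (fun z => v z (z * k)) (v1 s (s * k) + k * v2 s (s * k)).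
Proof.
move=> c1 d1 d2.
pose Q z := itvint 0 1 (fun q => v1 (s + q * (z - s)) (z * k)).
have vQ z : v z (z * k) = v s (z * k) + (z - s) * Q z.
  rewrite -itvintZ; last by cont.
  have h (q : R) : 0 <= q <= 1 -> is_derive q 1 (fun q => v (s + q * (z - s)) (z * k))
      ((z - s) * v1 (s + q * (z - s)) (z * k)).
    move=> _.
    apply: der_eq (@der_comp _ (v^~ (z * k)) (fun q => s + q * (z - s)) _ _ q (d1 _ _)
      (derD (der_cst s q) (derM (der_id q) (der_cst (z - s) q)))) _.
    by rewrite mul1r mulr0 addr0 add0r mulrC.
  rewrite (itvint_FTC2_closed ler01 _ h); last by cont.
  by rewrite mul1r mul0r addr0 addrC subrK addrC subrK.
have cQ : continuous Q by rewrite /Q; cont.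
have Qs : Q s = v1 s (s * k).
  by rewrite /Q; under eq_fun do rewrite subrr mulr0 addr0; rewrite itvint_cst// subr0 mulr1.
under eq_fun do rewrite vQ.
rewrite addrC.
have h : is_derive s 1 (fun z => v s (z * k)) (v2 s (s * k) * (1 * k + s * 0)).
  exact: (@der_comp _ (v s) (fun z => z * k) _ _ s (d2 s (s * k))
    (derM (der_id s) (der_cst k s))).
apply: der_eq (derD h (is_derive_root (cQ s))) _.
by rewrite Qs mulr0 addr0 mul1r mulrC.
Qed.

Lemma oscillation_le (f f' : R -> R) c d p q : continuous f' ->
  (forall x : R, is_derive x 1 f (f' x)) -> c <= p <= d -> c <= q <= d ->
  `|f p - f q| <= itvint c d (fun x => `|f' x|).
Proof.
move=> cf df; wlog pq : p q / q <= p.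
  by move=> wl; case: (leP q p) => [|/ltW] h; [|rewrite distrC => ? ?]; exact: wl.
move=> /andP[cp pd] /andP[cq qd].
rewrite -(itvint_FTC2_closed pq cf (fun x _ => df x)).
apply: le_trans (normr_itvint_le _ _ cf) _.
by apply: itvint_subset => //; cont.
Qed.
End rays.

(** * The Poincare inequality with logarithmic constant *)

Section log_poincare.
Context {R : realType}.
Implicit Types (a b c d s : R).

(** All estimates are made on iterated integrals; [integral_boxint] connects them with the product
    measure at the end. *)
Definition boxint a b c d (F : R -> R -> R) : R :=
  itvint a b (fun x => itvint c d (fun y => F x y)).

Lemma young (e A q : R) : 0 < e -> A * q <= e * q ^+ 2 + A ^+ 2 / (4 * e).
Proof.
move=> e0; rewrite -subr_ge0.
have -> : e * q ^+ 2 + A ^+ 2 / (4 * e) - A * q = (2 * e * q - A) ^+ 2 / (4 * e).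
  by field; rewrite gt_eqF.
by rewrite divr_ge0// ?sqr_ge0// mulr_ge0// ltW.
Qed.

Lemma le_boxint a b c d (F G : R -> R -> R) :
  continuous (fun z : R * R => F z.1 z.2) -> continuous (fun z : R * R => G z.1 z.2) ->
  (forall x y, a <= x <= b -> c <= y <= d -> F x y <= G x y) ->
  boxint a b c d F <= boxint a b c d G.
Proof.
move=> cF cG FG; apply: le_itvint; [cont|cont|move=> x xab].
by apply: le_itvint; [cont|cont|move=> y ycd; exact: FG].
Qed.

Lemma boxintD a b c d (F G : R -> R -> R) :
  continuous (fun z : R * R => F z.1 z.2) -> continuous (fun z : R * R => G z.1 z.2) ->
  boxint a b c d (fun x y => F x y + G x y) = boxint a b c d F + boxint a b c d G.
Proof.
move=> cF cG; rewrite /boxint -itvintD; [|cont|cont].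
by apply: itvint_eq => x _; rewrite itvintD//; cont.
Qed.

Lemma boxintZ a b c d r (F : R -> R -> R) :
  continuous (fun z : R * R => F z.1 z.2) ->
  boxint a b c d (fun x y => r * F x y) = r * boxint a b c d F.
Proof.
move=> cF; rewrite /boxint -itvintZ; [|cont].
by apply: itvint_eq => x _; rewrite itvintZ//; cont.
Qed.

Lemma boxint_cst a b c d r : a <= b -> c <= d ->
  boxint a b c d (fun _ _ => r) = r * (d - c) * (b - a).
Proof. by move=> ab cd; rewrite /boxint itvint_cst// itvint_cst. Qed.

Lemma eq_boxint a b c d (F G : R -> R -> R) :
  (forall x y, a <= x <= b -> c <= y <= d -> F x y = G x y) ->
  boxint a b c d F = boxint a b c d G.
Proof. by move=> FG; apply: itvint_eq => x hx; apply: itvint_eq => y; exact: FG. Qed.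

Lemma boxint_ge0 a b c d (F : R -> R -> R) :
  (forall x y, a <= x <= b -> c <= y <= d -> 0 <= F x y) -> 0 <= boxint a b c d F.
Proof. by move=> F0; apply: itvint_ge0 => x hx; apply: itvint_ge0 => y; exact: F0. Qed.

Lemma boxint_subset a b c d a' b' c' d' (F : R -> R -> R) :
  continuous (fun z : R * R => F z.1 z.2) -> (forall x y, 0 <= F x y) ->
  a' <= a -> b <= b' -> c' <= c -> d <= d' ->
  boxint a b c d F <= boxint a' b' c' d' F.
Proof.
move=> cF F0 a'a bb' c'c dd'.
apply: (@le_trans _ _ (itvint a b (fun x => itvint c' d' (F x)))).
  apply: le_itvint; [cont|cont|move=> x _].
  by apply: itvint_subset => //; cont.
apply: itvint_subset => //; first by cont.
by move=> x; exact: itvint_ge0.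
Qed.

Variables (v v1 v2 w : R -> R -> R) (L rho e W : R).
Hypotheses (L0 : 0 < L) (Lrho : 2 * L <= rho) (e0 : 0 < e).
Hypotheses (cv : continuous (fun z : R * R => v z.1 z.2))
  (cv1 : continuous (fun z : R * R => v1 z.1 z.2))
  (cv2 : continuous (fun z : R * R => v2 z.1 z.2))
  (cw : continuous (fun z : R * R => w z.1 z.2)).
Hypotheses (dv1 : forall x y : R, is_derive x 1 (v^~ y) (v1 x y))
  (dv2 : forall x y : R, is_derive y 1 (v x) (v2 x y)).
Hypothesis v_bd : forall y, v rho y = 0.
Hypothesis w_bd : forall x y, 0 <= w x y <= W.

Ltac slra := move: (L0) (Lrho) (e0); lra.

Let H1 y := itvint (- (2 * L)) (2 * L) (fun s => `|v1 s y|).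
Let H2 x := itvint (- (2 * L)) (2 * L) (fun s => `|v2 x s|).
Let K k := itvint L rho (fun s => `|v1 s (s * k)| + `|v2 s (s * k)|).

Let cH1 : continuous H1. Proof. by rewrite /H1; cont. Qed.
Let cH2 : continuous H2. Proof. by rewrite /H2; cont. Qed.
Let cK : continuous K. Proof. by rewrite /K; cont. Qed.

(** One term for each leg of the path through [(z, y)] and [(z, z * k)] to [(rho, rho * k)]. As
    [0 <= z * k <= 2 * L], the first two legs stay in the square of half-side [2 * L]. *)
Let bound3 x y z k : - L <= x <= L -> - L <= y <= L -> L <= z <= 2 * L ->
  0 <= k <= 1 -> `|v x y| <= H1 y + H2 z + K k.
Proof.
move=> /andP[x1 x2] /andP[y1 y2] /andP[z1 z2] /andP[k0 k1].
have h1 : `|v x y - v z y| <= H1 y.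
  by apply: (@oscillation_le _ (v^~ y) (v1^~ y) _ _ _ _ _ (fun s => dv1 s y)); [cont|lra|lra].
have h2 : `|v z y - v z (z * k)| <= H2 z.
  by apply: (@oscillation_le _ (v z) (v2 z) _ _ _ _ _ (fun s => dv2 z s)); [cont|lra|nra].
have h3 : `|v z (z * k)| <= K k.
  have cf : continuous (fun s => v1 s (s * k) + k * v2 s (s * k)) by cont.
  have := @oscillation_le _ (fun s => v s (s * k)) _ L rho rho z cf
    (fun s => is_derive_ray k s cv1 dv1 dv2).
  have hz : L <= z <= rho by rewrite z1 (le_trans z2 Lrho).
  have hr : L <= rho <= rho by rewrite lexx (le_trans z1)// (le_trans z2).
  move=> /(_ hr hz); rewrite v_bd sub0r normrN => h; apply: le_trans h _.
  apply: le_itvint; [cont|cont|move=> s _].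
  rewrite (le_trans (ler_normD _ _))// lerD2l normrM ger0_norm//.
  by rewrite ler_piMl.
have -> : v x y = (v x y - v z y) + (v z y - v z (z * k)) + v z (z * k) by ring.
rewrite (le_trans (ler_normD _ _))// lerD// (le_trans (ler_normD _ _))// lerD//.
Qed.

Let HH := itvint L (2 * L) H2.
Let KK := itvint 0 1 K.

(** Average of [bound3] over [k] in [[0, 1]] and integral over [z] in [[L, 2 * L]]: the second and
    third legs become double integrals. The first one does so later, when [y] is integrated. *)
Let bound1 x y : - L <= x <= L -> - L <= y <= L ->
  L * `|v x y| <= L * H1 y + HH + L * KK.
Proof.
move=> hx hy.
have h z : L <= z <= 2 * L -> `|v x y| <= H1 y + H2 z + KK.
  move=> hz; have := @le_itvint _ 0 1 (fun=> `|v x y|) (fun k => H1 y + H2 z + K k).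
  rewrite itvint_cst// subr0 mulr1 itvintD; [|cont|cont].
  rewrite itvint_cst// subr0 mulr1; apply; [cont|cont|].
  by move=> k hk; exact: bound3.
have := @le_itvint _ L (2 * L) (fun=> `|v x y|) (fun z => (H1 y + KK) + H2 z).
rewrite itvint_cst; last lra.
rewrite itvintD; [|cont|cont]; rewrite itvint_cst; last lra.
have -> : 2 * L - L = L by ring.
move=> h'; have {h'} := h' _ _ _; rewrite -/HH => h'.
apply: le_trans (_ : _ <= (H1 y + KK) * L + HH) _; last lra.
rewrite mulrC; apply: h'; [cont|cont|].
by move=> z hz; have := h z hz; lra.
Qed.

Let G1 := boxint (- rho) rho (- rho) rho (fun x y => v1 x y ^+ 2).
Let G2 := boxint (- rho) rho (- rho) rho (fun x y => v2 x y ^+ 2).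
Let M := boxint (- L) L (- L) L w.

Let c2L : 0 <= 2 * L. Proof. by rewrite mulr_ge0// ltW. Qed.
Let cL : 0 <= L. Proof. exact: ltW. Qed.
Let Lr : L <= rho. Proof. by apply: le_trans Lrho; rewrite ler_peMl// ler1n. Qed.
Let W0 : 0 <= W.
Proof. by have /andP[h1 h2] := w_bd 0 0; exact: le_trans h2. Qed.

(** [2 * L * W] is the coefficient of this term in [log_poincare]. Young's inequality leaves the
    constant [(2 * L * W) ^+ 2 / (4 * e)], integrated over a rectangle of area [8 * L ^+ 2]. *)
Let boundH1 : 2 * L * W * itvint (- L) L H1 <= e * G1 + 8 * L ^+ 4 * W ^+ 2 / e.
Proof.
rewrite -itvintZ//.
have -> : itvint (- L) L (fun y => 2 * L * W * H1 y) =
    boxint (- L) L (- (2 * L)) (2 * L) (fun y x => 2 * L * W * `|v1 x y|).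
  by apply: itvint_eq => y _; rewrite itvintZ//; cont.
apply: (@le_trans _ _ (boxint (- L) L (- (2 * L)) (2 * L) (fun y x =>
    e * v1 x y ^+ 2 + (2 * L * W) ^+ 2 / (4 * e)))).
  apply: le_boxint; [cont|cont|move=> x y _ _].
  by rewrite -(real_normK (num_real (v1 _ _))); exact: young.
rewrite boxintD; [|cont|cont]; rewrite boxint_cst; [|slra|slra].
rewrite lerD//; last by rewrite le_eqVlt; apply/orP; left; apply/eqP; field; rewrite gt_eqF.
rewrite boxintZ; last by cont.
rewrite (ler_pM2l e0) /G1 {2}/boxint itvint_swap; [|slra|cont].
apply: boxint_subset; [cont|by move=> *; exact: sqr_ge0|..]; slra.
Qed.

(** Same argument, with coefficient [4 * L * W] and a rectangle of area [4 * L ^+ 2]. *)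
Let boundH2 : 4 * L * W * HH <= e * G2 + 16 * L ^+ 4 * W ^+ 2 / e.
Proof.
rewrite -itvintZ//.
have -> : itvint L (2 * L) (fun x => 4 * L * W * H2 x) =
    boxint L (2 * L) (- (2 * L)) (2 * L) (fun x y => 4 * L * W * `|v2 x y|).
  by apply: itvint_eq => y _; rewrite itvintZ//; cont.
apply: (@le_trans _ _ (boxint L (2 * L) (- (2 * L)) (2 * L) (fun x y =>
    e * v2 x y ^+ 2 + (4 * L * W) ^+ 2 / (4 * e)))).
  apply: le_boxint; [cont|cont|move=> x y _ _].
  by rewrite -(real_normK (num_real (v2 _ _))); exact: young.
rewrite boxintD; [|cont|cont]; rewrite boxint_cst; [|slra|slra].
rewrite lerD//; last by rewrite le_eqVlt; apply/orP; left; apply/eqP; field; rewrite gt_eqF.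
rewrite boxintZ; last by cont.
rewrite (ler_pM2l e0) /G2.
apply: boxint_subset; [cont|by move=> *; exact: sqr_ge0|..]; slra.
Qed.

(* Truncated at [L] so as to be continuous on the whole line. *)
Let il (s : R) := (Num.max L s)^-1.
Let cil : continuous il.
Proof.
move=> s; apply: cvgV; first by rewrite gt_eqF// lt_max L0.
have cm : continuous (fun s : R => Num.max L s) by cont.
exact: cm.
Qed.

Let int_il : itvint L rho il = ln rho - ln L.
Proof.
apply: itvint_FTC2_closed => // s /andP[Ls _]; rewrite /il max_r//.
by apply: is_derive1_ln; exact: lt_le_trans Ls.
Qed.

(** Young's inequality with parameter [e * s]: the factor [s] in front of the square is the Jacobian
    of [k |-> s * k], and the remainder is proportional to [1 / s], whose integral over [[L, rho]]
    is the logarithm. *)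
Let sector_slice (q : R -> R) s : continuous q -> L <= s <= rho ->
  itvint 0 1 (fun k => M * `|q (s * k)|) <=
  e * itvint (- rho) rho (fun y => q y ^+ 2) + M ^+ 2 / (4 * e) * il s.
Proof.
move=> cq /andP[Ls sr]; have s0 : 0 < s := lt_le_trans L0 Ls.
rewrite /il max_r//.
apply: (@le_trans _ _ (itvint 0 1 (fun k =>
    e * s * q (s * k) ^+ 2 + M ^+ 2 / (4 * (e * s))))).
  apply: le_itvint; [cont|cont|move=> k _].
  by rewrite -(real_normK (num_real (q _))); apply: young; rewrite mulr_gt0.
rewrite itvintD; [|cont|cont]; rewrite itvint_cst//.
rewrite lerD//; last first.
  by rewrite le_eqVlt; apply/orP; left; apply/eqP; field; rewrite !gt_eqF.
rewrite itvintZ; last by cont.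
rewrite -mulrA ler_pM2l//.
rewrite (itvint_scale (f := fun y => q y ^+ 2)); [|exact: ltW|cont].
apply: itvint_subset; [cont|by move=> *; exact: sqr_ge0|slra|by []].
Qed.

Let boundK : M * KK <= e * (G1 + G2) + M ^+ 2 / (2 * e) * (ln rho - ln L).
Proof.
rewrite /KK -itvintZ//.
have -> : itvint 0 1 (fun k => M * K k) =
    itvint L rho (fun s => itvint 0 1 (fun k => M * `|v1 s (s * k)|)
                         + itvint 0 1 (fun k => M * `|v2 s (s * k)|)).
  rewrite [RHS](@itvint_eq _ _ _ _ (fun s => itvint 0 1 (fun k =>
      M * `|v1 s (s * k)| + M * `|v2 s (s * k)|))); last first.
    by move=> s _; rewrite itvintD; [|cont|cont].
  rewrite (itvint_swap _ _ Lr); last by cont.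
  apply: itvint_eq => k _; rewrite /K -itvintZ; last by cont.
  by apply: itvint_eq => s _; rewrite mulrDr.
apply: (@le_trans _ _ (itvint L rho (fun s =>
   (e * itvint (- rho) rho (fun y => v1 s y ^+ 2) + M ^+ 2 / (4 * e) * il s) +
   (e * itvint (- rho) rho (fun y => v2 s y ^+ 2) + M ^+ 2 / (4 * e) * il s)))).
  apply: le_itvint; [cont|cont|move=> s hs].
  by rewrite lerD//; apply: sector_slice => //; cont.
rewrite !itvintD; [|cont..]; rewrite !itvintZ; [|cont..].
rewrite int_il.
have h (q : R -> R -> R) : continuous (fun z : R * R => q z.1 z.2) ->
    itvint L rho (fun s => itvint (- rho) rho (fun y => q s y ^+ 2)) <=
    boxint (- rho) rho (- rho) rho (fun x y => q x y ^+ 2).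
  move=> cq; apply: boxint_subset; [cont|by move=> *; exact: sqr_ge0|..]; slra.
have := ler_wpM2l (ltW e0) (h _ cv1).
have := ler_wpM2l (ltW e0) (h _ cv2).
have -> : M ^+ 2 / (2 * e) = M ^+ 2 / (4 * e) + M ^+ 2 / (4 * e).
  by field; rewrite gt_eqF.
rewrite -/G1 -/G2; slra.
Qed.

(* The logarithm comes from the flux of [v] through the sector
   [{(s, s * k) : L <= s <= rho, 0 <= k <= 1}], on which the
   area element is [s ds dk]. *)
Lemma log_poincare :
  boxint (- L) L (- L) L (fun x y => w x y * `|v x y|) <=
  2 * e * (boxint (- rho) rho (- rho) rho (fun x y => v1 x y ^+ 2) +
           boxint (- rho) rho (- rho) rho (fun x y => v2 x y ^+ 2))
  + 24 * L ^+ 4 * W ^+ 2 / e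
  + boxint (- L) L (- L) L w ^+ 2 / (2 * e) * (ln rho - ln L).
Proof.
rewrite -/G1 -/G2 -/M.
have HH0 : 0 <= HH by apply: itvint_ge0 => x _; apply: itvint_ge0.
have h : L * boxint (- L) L (- L) L (fun x y => w x y * `|v x y|) <=
    W * L * (2 * L) * itvint (- L) L H1 + W * HH * (4 * L ^+ 2) + L * KK * M.
  rewrite -(boxintZ _ _ _ _ L); last by cont.
  apply: (@le_trans _ _ (boxint (- L) L (- L) L (fun x y =>
      (W * L * H1 y + W * HH) + L * KK * w x y))).
    apply: le_boxint; [cont|cont|move=> x y hx hy].
    have /andP[w0 wW] := w_bd x y.
    rewrite mulrCA.
    apply: le_trans (ler_wpM2l w0 (bound1 hx hy)) _.
    (* Only the terms of the coordinate segments are estimated with [W]; the term of the rays keeps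
       [w], which integrates to [M]. *)
    rewrite mulrDr [w x y * (L * KK)]mulrC lerD2r -mulrA -mulrDr.
    apply: ler_wpM2r wW.
    by rewrite addr_ge0// mulr_ge0//; exact: itvint_ge0.
  rewrite boxintD; [|cont|cont]; rewrite boxintD; [|cont|cont].
  rewrite boxint_cst; [|slra|slra]; rewrite (boxintZ _ _ _ _ _ cw) -/M.
  have -> : boxint (- L) L (- L) L (fun _ y => W * L * H1 y) =
      W * L * itvint (- L) L H1 * (L - - L).
    by rewrite -(itvintZ _ _ _ cH1) -itvint_cst//; slra.
  by rewrite le_eqVlt; apply/orP; left; apply/eqP; ring.
rewrite -(ler_pM2l L0); apply: le_trans h _.
apply: (@le_trans _ _ (L * (2 * L * W * itvint (- L) L H1 + 4 * L * W * HH + M * KK))).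
  by rewrite le_eqVlt; apply/orP; left; apply/eqP; ring.
rewrite (ler_pM2l L0).
move: boundH1 boundH2 boundK; slra.
Qed.
End log_poincare.

(** * Primitives in time *)

Section time_integral.
Context {R : realType}.
Implicit Types (f g : R -> R -> R -> R) (t x y : R).

Lemma derX2 (f : R -> R) x df : is_derive x 1 f df ->
  is_derive x 1 (fun z => f z ^+ 2) (2 * f x * df).
Proof.
move=> h; apply: der_eq (derM h h) _.
by rewrite mulrC; ring.
Qed.

(* For [0 <= t] this is the primitive [\int_0^t f s x y ds]; written in this way
   it is continuous for all real [t]. *)
Definition tint f t x y := t * itvint 0 1 (fun s => f (t * s) x y).

Lemma cont_tint f : continuous (fun z : R * (R * R) => f z.1 z.2.1 z.2.2) ->
  continuous (fun z : R * (R * R) => tint f z.1 z.2.1 z.2.2).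
Proof. by move=> cf; rewrite /tint; cont. Qed.

Lemma tintE f t x y : continuous (fun z : R * (R * R) => f z.1 z.2.1 z.2.2) ->
  0 <= t -> tint f t x y = itvint 0 t (fun s => f s x y).
Proof. by move=> cf t0; apply: (itvint_scale (f := fun s => f s x y)) => //; cont. Qed.

Lemma tint0 f x y : tint f 0 x y = 0.
Proof. by rewrite /tint mul0r. Qed.

Lemma is_derive_tint f t x y :
  continuous (fun z : R * (R * R) => f z.1 z.2.1 z.2.2) -> 0 < t ->
  is_derive t 1 (fun t => tint f t x y) (f t x y).
Proof.
move=> cf t0.
have cfx : continuous (fun s => f s x y) by cont.
apply: near_eq_is_derive (is_derive_itvint cfx t0).
by near=> z; rewrite tintE//; apply: ltW; near: z; exact: lt_nbhsr.
Unshelve. all: by end_near. Qed.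

Lemma is_derive_tint1 f f' t x y :
  continuous (fun z : R * (R * R) => f z.1 z.2.1 z.2.2) ->
  continuous (fun z : R * (R * R) => f' z.1 z.2.1 z.2.2) ->
  (forall t x y, is_derive x 1 (fun z => f t z y) (f' t x y)) ->
  is_derive x 1 (fun z => tint f t z y) (tint f' t x y).
Proof.
move=> cf cf' df.
have h : is_derive x 1 (fun z => itvint 0 1 (fun s => f (t * s) z y))
                       (itvint 0 1 (fun s => f' (t * s) x y)).
  apply: (@is_derive_under_itvint _ 0 1 (fun z s => f (t * s) z y)
    (fun z s => f' (t * s) z y) (x - 1)); [by rewrite ltrBlDr ltrDl|..].
  - by move=> z; cont.
  - by cont.
by apply: der_eq (derM (der_cst t x) h) _; rewrite mul0r add0r.
Qed.

Lemma is_derive_tint2 f f' t x y :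
  continuous (fun z : R * (R * R) => f z.1 z.2.1 z.2.2) ->
  continuous (fun z : R * (R * R) => f' z.1 z.2.1 z.2.2) ->
  (forall t x y, is_derive y 1 (fun z => f t x z) (f' t x y)) ->
  is_derive y 1 (fun z => tint f t x z) (tint f' t x y).
Proof.
move=> cf cf' df.
have h : is_derive y 1 (fun z => itvint 0 1 (fun s => f (t * s) x z))
                       (itvint 0 1 (fun s => f' (t * s) x y)).
  apply: (@is_derive_under_itvint _ 0 1 (fun z s => f (t * s) x z)
    (fun z s => f' (t * s) x z) (y - 1)); [by rewrite ltrBlDr ltrDl|..].
  - by move=> z; cont.
  - by cont.
by apply: der_eq (derM (der_cst t y) h) _; rewrite mul0r add0r.
Qed.

End time_integral.

(** * Vanishing of nonnegative integrands; the squared positive part *)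

Section vanishing.
Context {R : realType}.
Implicit Types (a b c d x y : R).

(** The integral from [a] to [z] vanishes for every [z <= b], hence so does its derivative [f x]. *)
Lemma itvint_le0_eq0 a b x (f : R -> R) : continuous f -> (forall x, 0 <= f x) ->
  itvint a b f <= 0 -> a < x < b -> f x = 0.
Proof.
move=> cf f0 If /andP[ax xb].
have G0 z : z <= b -> itvint a z f = 0.
  move=> zb; apply/eqP; rewrite eq_le itvint_ge0// andbT.
  by apply: le_trans If; apply: itvint_subset.
have h : is_derive x 1 (fun z => itvint a z f) 0.
  apply: near_eq_is_derive (der_cst 0 x); near=> z.
  by rewrite G0//; apply/ltW; near: z; exact: lt_nbhsl.
have h' := is_derive_itvint cf ax.
by case: h => _ <-; case: h' => _ ->.
Unshelve. all: by end_near. Qed.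

Lemma boxint_le0_eq0 a b c d x y (F : R -> R -> R) :
  continuous (fun z : R * R => F z.1 z.2) -> (forall x y, 0 <= F x y) ->
  boxint a b c d F <= 0 -> a < x < b -> c < y < d -> F x y = 0.
Proof.
move=> cF F0 IF hx hy.
apply: (@itvint_le0_eq0 c d) => //; first by cont.
rewrite (@itvint_le0_eq0 a b x (fun x => itvint c d (F x)))//; first by cont.
by move=> z; apply: itvint_ge0.
Qed.

(** The square makes the positive part continuously differentiable, as a cut-off in the energy
    estimate has to be. *)
Definition sqpos x : R := Num.max 0 x ^+ 2.

Lemma cont_sqpos : continuous sqpos.
Proof. by rewrite /sqpos; apply: contX; exact: (cont_max (@cont_cst _ _ 0) (@cont_id _)). Qed.

Lemma is_derive_sqpos x : is_derive x 1 sqpos (2 * Num.max 0 x).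
Proof.
have [x0|x0|->] := ltgtP x 0.
- rewrite mulr0; apply: near_eq_is_derive (der_cst 0 x); near=> z.
  have z0 : z < 0 by near: z; exact: lt_nbhsl.
  by rewrite /sqpos (max_l (ltW z0)) expr0n.
- apply: der_eq (_ : is_derive x 1 sqpos (2 * x * 1)) _; last first.
    by rewrite mulr1.
  apply: near_eq_is_derive (derX2 (der_id x)); near=> z; have z0 : 0 < z by near: z; exact: lt_nbhsr.
  by rewrite /sqpos (max_r (ltW z0)).
(* At 0, [is_derive_root] applies since [sqpos z = z * Num.max 0 z]. *)
- have cm : continuous (fun z : R => Num.max 0 z).
    exact: (cont_max (@cont_cst _ _ 0) (@cont_id _)).
  apply: der_eq (_ : is_derive (0 : R) (1 : R) sqpos (Num.max 0 0)) _; last first.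
    by rewrite maxxx mulr0.
  apply: near_eq_is_derive (is_derive_root (cm 0)); near=> z.
  by rewrite subr0 /sqpos; case: (leP 0 z) => z0; rewrite ?mulr0 ?expr0n.
Unshelve. all: by end_near. Qed.

Lemma sqpos_ge0 x : 0 <= sqpos x. Proof. exact: sqr_ge0. Qed.

Lemma sqpos_eq0 x : x <= 0 -> sqpos x = 0.
Proof. by move=> x0; rewrite /sqpos max_l// expr0n. Qed.

Lemma der_sqpos (f : R -> R) x df : is_derive x 1 f df ->
  is_derive x 1 (fun z => sqpos (f z)) (2 * Num.max 0 (f x) * df).
Proof. by move=> h; apply: der_comp h; exact: is_derive_sqpos. Qed.

End vanishing.

(** * Weighted energy estimate and finite propagation speed *)

Ltac der := cbv beta; repeat match goal with
  | |- is_derive _ _ (fun _ => ?a) _ => eapply der_cst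
  | |- is_derive _ _ (fun z => z) _ => eapply der_id
  | |- is_derive _ _ (fun z => _ + _) _ => eapply derD
  | |- is_derive _ _ (fun z => - _) _ => eapply derN
  | |- is_derive _ _ (fun z => _ * _) _ => eapply derM
  | |- is_derive _ _ (GRing.mul ?a) _ => eapply (derM (der_cst a _) (der_id _))
  | |- is_derive _ _ (fun z => _ ^+ 2) _ => eapply derX2
  | |- is_derive _ _ (fun z => sqpos _) _ => eapply der_sqpos
  | H : forall _, _ |- is_derive _ _ _ _ => solve [eapply H; assumption]
  end.

(* [p] and [q] are the components of the displacement, lower case suffixes denote
   derivatives, and capital letters primitives in time: [Pxy] stands for
   [\int_0^t] of the [y]-derivative of [px].  Also [m] stands for [b ^+ 2 - a ^+ 2]. *)
Section energy.
Context {R : realType}.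
Variables (a m : R) (p q pt qt px py qx qy Px Py Qx Qy : R -> R -> R -> R).
Variables (Pxx Pxy Pyy Qxx Qyx Qyy : R -> R -> R -> R) (p1 q1 : R -> R -> R).
Notation cont3 f := (continuous (fun z : R * (R * R) => f z.1 z.2.1 z.2.2)).
Hypotheses (m0 : 0 <= m)
  (cp : cont3 p) (cq : cont3 q) (cpt : cont3 pt) (cqt : cont3 qt)
  (cpx : cont3 px) (cpy : cont3 py) (cqx : cont3 qx) (cqy : cont3 qy)
  (cPx : cont3 Px) (cPy : cont3 Py) (cQx : cont3 Qx) (cQy : cont3 Qy)
  (cPxx : cont3 Pxx) (cPxy : cont3 Pxy) (cPyy : cont3 Pyy)
  (cQxx : cont3 Qxx) (cQyx : cont3 Qyx) (cQyy : cont3 Qyy)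
  (cp1 : continuous (fun z : R * R => p1 z.1 z.2))
  (cq1 : continuous (fun z : R * R => q1 z.1 z.2)).
Hypotheses
  (dpt : forall t x y : R, is_derive t 1 (fun t => p t x y) (pt t x y))
  (dqt : forall t x y : R, is_derive t 1 (fun t => q t x y) (qt t x y))
  (dpx : forall t x y : R, is_derive x 1 (fun x => p t x y) (px t x y))
  (dqx : forall t x y : R, is_derive x 1 (fun x => q t x y) (qx t x y))
  (dpy : forall t x y : R, is_derive y 1 (fun y => p t x y) (py t x y))
  (dqy : forall t x y : R, is_derive y 1 (fun y => q t x y) (qy t x y))
  (dPxt : forall t x y : R, 0 < t -> is_derive t 1 (fun t => Px t x y) (px t x y))
  (dPyt : forall t x y : R, 0 < t -> is_derive t 1 (fun t => Py t x y) (py t x y))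
  (dQxt : forall t x y : R, 0 < t -> is_derive t 1 (fun t => Qx t x y) (qx t x y))
  (dQyt : forall t x y : R, 0 < t -> is_derive t 1 (fun t => Qy t x y) (qy t x y))
  (dPxx : forall t x y : R, is_derive x 1 (fun x => Px t x y) (Pxx t x y))
  (dPxy : forall t x y : R, is_derive y 1 (fun y => Px t x y) (Pxy t x y))
  (dPyy : forall t x y : R, is_derive y 1 (fun y => Py t x y) (Pyy t x y))
  (dQxx : forall t x y : R, is_derive x 1 (fun x => Qx t x y) (Qxx t x y))
  (dQyx : forall t x y : R, is_derive x 1 (fun x => Qy t x y) (Qyx t x y))
  (dQyy : forall t x y : R, is_derive y 1 (fun y => Qy t x y) (Qyy t x y)).
Hypotheses
  (eq_p : forall t x y, 0 <= t -> pt t x y =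
     p1 x y + a ^+ 2 * (Pxx t x y + Pyy t x y) + m * (Pxx t x y + Qyx t x y))
  (eq_q : forall t x y, 0 <= t -> qt t x y =
     q1 x y + a ^+ 2 * (Qxx t x y + Qyy t x y) + m * (Pxy t x y + Qyy t x y)).

(** Energy density of v; since v_t = u, its kinetic part is the square of the displacement. *)
Definition energy t x y :=
  2^-1 * (p t x y ^+ 2 + q t x y ^+ 2) +
  2^-1 * (a ^+ 2 * (Px t x y ^+ 2 + Py t x y ^+ 2 + Qx t x y ^+ 2 + Qy t x y ^+ 2)) +
  2^-1 * (m * (Px t x y + Qy t x y) ^+ 2).
(** The sign is such that the time derivative of the energy is plus the divergence of
    [(flux1, flux2)], up to the source. *)
Definition flux1 t x y :=
  p t x y * (a ^+ 2 * Px t x y + m * (Px t x y + Qy t x y)) +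
  q t x y * (a ^+ 2 * Qx t x y).
Definition flux2 t x y :=
  p t x y * (a ^+ 2 * Py t x y) +
  q t x y * (a ^+ 2 * Qy t x y + m * (Px t x y + Qy t x y)).

Lemma energy_ge0 t x y : 0 <= energy t x y.
Proof.
rewrite /energy.
by do ![apply: sqr_ge0|apply: m0|rewrite invr_ge0//|apply: addr_ge0|apply: mulr_ge0].
Qed.

Lemma cont_energy : cont3 energy. Proof. by rewrite /energy; cont. Qed.
Lemma cont_flux1 : cont3 flux1. Proof. by rewrite /flux1; cont. Qed.
Lemma cont_flux2 : cont3 flux2. Proof. by rewrite /flux2; cont. Qed.

Let energyt t x y :=
  p t x y * pt t x y + q t x y * qt t x y +
  a ^+ 2 * (Px t x y * px t x y + Py t x y * py t x y +
            Qx t x y * qx t x y + Qy t x y * qy t x y) +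
  m * (Px t x y + Qy t x y) * (px t x y + qy t x y).
Let flux1x t x y :=
  px t x y * (a ^+ 2 * Px t x y + m * (Px t x y + Qy t x y)) +
  p t x y * (a ^+ 2 * Pxx t x y + m * (Pxx t x y + Qyx t x y)) +
  qx t x y * (a ^+ 2 * Qx t x y) + q t x y * (a ^+ 2 * Qxx t x y).
Let flux2y t x y :=
  py t x y * (a ^+ 2 * Py t x y) + p t x y * (a ^+ 2 * Pyy t x y) +
  qy t x y * (a ^+ 2 * Qy t x y + m * (Px t x y + Qy t x y)) +
  q t x y * (a ^+ 2 * Qyy t x y + m * (Pxy t x y + Qyy t x y)).

Let cont_energyt : cont3 energyt. Proof. by rewrite /energyt; cont. Qed.
Let cont_flux1x : cont3 flux1x. Proof. by rewrite /flux1x; cont. Qed.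
Let cont_flux2y : cont3 flux2y. Proof. by rewrite /flux2y; cont. Qed.

Let is_derive_energy (t x y : R) : 0 < t ->
  is_derive t 1 (fun t => energy t x y) (energyt t x y).
Proof.
move=> t0; rewrite /energy.
eapply der_eq; [der|].
by rewrite /energyt; field.
Qed.

Let is_derive_flux1 (t x y : R) : is_derive x 1 (fun x => flux1 t x y) (flux1x t x y).
Proof.
rewrite /flux1; eapply der_eq; [der|].
rewrite /flux1x; ring.
Qed.

Let is_derive_flux2 (t x y : R) : is_derive y 1 (fun y => flux2 t x y) (flux2y t x y).
Proof.
rewrite /flux2; eapply der_eq; [der|].
rewrite /flux2y; ring.
Qed.

(** The mixed derivatives match in their given order: [Qyx] and [Pxy] occur in the equations as
    components of grad div, and in the divergence of the flux from [Qy] differentiated in x and [Px]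
    differentiated in y. *)
Let energy_balance t x y : 0 <= t ->
  energyt t x y = flux1x t x y + flux2y t x y + (p1 x y * p t x y + q1 x y * q t x y).
Proof.
move=> t0; rewrite /energyt (eq_p _ _ t0) (eq_q _ _ t0) /flux1x /flux2y; ring.
Qed.

(** The hypothesis on the derivatives of [psi] says that the time derivative of [psi * energy] is at
    most the divergence of [psi] times the flux, plus [psi] times the source; the boundary
    conditions make this divergence integrate to 0. It is used with a shrinking cut-off and with
    [psi = 1]. *)
Lemma weighted_energy_le (psi psit psix psiy : R -> R -> R -> R) (T x0 x1 y0 y1 : R) :
  0 <= T -> x0 <= x1 -> y0 <= y1 ->
  cont3 psi -> cont3 psit -> cont3 psix -> cont3 psiy ->
  (forall t x y : R, is_derive t 1 (fun t => psi t x y) (psit t x y)) ->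
  (forall t x y : R, is_derive x 1 (fun x => psi t x y) (psix t x y)) ->
  (forall t x y : R, is_derive y 1 (fun y => psi t x y) (psiy t x y)) ->
  (forall t x y, 0 <= t <= T ->
     psit t x y * energy t x y <= psix t x y * flux1 t x y + psiy t x y * flux2 t x y) ->
  (forall t y, 0 <= t <= T ->
     psi t x0 y * flux1 t x0 y = 0 /\ psi t x1 y * flux1 t x1 y = 0) ->
  (forall t x, 0 <= t <= T ->
     psi t x y0 * flux2 t x y0 = 0 /\ psi t x y1 * flux2 t x y1 = 0) ->
  boxint x0 x1 y0 y1 (fun x y => psi T x y * energy T x y) <=
  boxint x0 x1 y0 y1 (fun x y => psi 0 x y * energy 0 x y) +
  boxint x0 x1 y0 y1 (fun x y => itvint 0 T (fun t =>
    psi t x y * (p1 x y * p t x y + q1 x y * q t x y))).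
Proof.
move=> T0 x01 y01 cs cst csx csy dst dsx dsy psiP bd1 bd2.
have cE := cont_energy; have cF1 := cont_flux1; have cF2 := cont_flux2.
have cEt := cont_energyt; have cF1x := cont_flux1x; have cF2y := cont_flux2y.
pose gx t x y := psix t x y * flux1 t x y + psi t x y * flux1x t x y.
pose gy t x y := psiy t x y * flux2 t x y + psi t x y * flux2y t x y.
pose g t x y := psi t x y * (p1 x y * p t x y + q1 x y * q t x y).
have cgx : cont3 gx by rewrite /gx; cont.
have cgy : cont3 gy by rewrite /gy; cont.
have cg : cont3 g by rewrite /g; cont.
have Igx : boxint x0 x1 y0 y1 (fun x y => itvint 0 T (fun t => gx t x y)) = 0.
  rewrite /boxint (itvint_swap _ _ x01); last by cont.
  rewrite -[RHS](mul0r (y1 - y0)) -(itvint_cst 0 y01).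
  apply: itvint_eq => y _; rewrite (itvint_swap _ _ x01); last by cont.
  rewrite -[RHS](mul0r (T - 0)) -(itvint_cst 0 T0); apply: itvint_eq => t ht.
  have h (x : R) : x0 <= x <= x1 ->
    is_derive x 1 (fun x => psi t x y * flux1 t x y) (gx t x y).
    by move=> _; apply: (derM (dsx t x y) (is_derive_flux1 t x y)).
  rewrite (itvint_FTC2_closed x01 _ h); last by cont.
  by have [-> ->] := bd1 t y ht; rewrite subrr.
have Igy : boxint x0 x1 y0 y1 (fun x y => itvint 0 T (fun t => gy t x y)) = 0.
  rewrite /boxint -[RHS](mul0r (x1 - x0)) -(itvint_cst 0 x01).
  apply: itvint_eq => x _; rewrite (itvint_swap _ _ y01); last by cont.
  rewrite -[RHS](mul0r (T - 0)) -(itvint_cst 0 T0); apply: itvint_eq => t ht.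
  have h (y : R) : y0 <= y <= y1 ->
    is_derive y 1 (fun y => psi t x y * flux2 t x y) (gy t x y).
    by move=> _; apply: (derM (dsy t x y) (is_derive_flux2 t x y)).
  rewrite (itvint_FTC2_closed y01 _ h); last by cont.
  by have [-> ->] := bd2 t x ht; rewrite subrr.
have key x y : psi T x y * energy T x y <= psi 0 x y * energy 0 x y +
    (itvint 0 T (fun t => g t x y) + itvint 0 T (fun t => gx t x y) +
     itvint 0 T (fun t => gy t x y)).
  rewrite -lerBlDl -itvintD; [|cont|cont]; rewrite -itvintD; [|cont|cont].
  have ch : continuous (fun t => psi t x y * energy t x y) by cont.
  have h (t : R) : 0 < t < T -> is_derive t 1 (fun t => psi t x y * energy t x y)
      (psit t x y * energy t x y + psi t x y * energyt t x y).
    by move=> /andP[t0 _]; apply: (derM (dst t x y) (is_derive_energy x y t0)).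
  (* The derivative of the energy is known for [0 < t] only; continuity accounts for [t = 0]. *)
  rewrite -(itvint_FTC2 T0 _ (fun x _ => ch x) h); last by cont.
  apply: le_itvint; [cont|cont|move=> t ht].
  have /andP[t0 _] := ht.
  rewrite (energy_balance x y t0) [leLHS]addrC.
  apply: le_trans (lerD (lexx _) (psiP t x y ht)) _.
  by rewrite le_eqVlt; apply/orP; left; apply/eqP; rewrite /g /gx /gy; ring.
apply: (@le_trans _ _ (boxint x0 x1 y0 y1 (fun x y => psi 0 x y * energy 0 x y +
    (itvint 0 T (fun t => g t x y) + itvint 0 T (fun t => gx t x y) +
     itvint 0 T (fun t => gy t x y))))).
  by apply: le_boxint; [cont|cont|].
have cs0 : continuous (fun z : R * R => psi 0 z.1 z.2 * energy 0 z.1 z.2) by cont.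
have cIg : continuous (fun z : R * R => itvint 0 T (fun t => g t z.1 z.2)) by cont.
have cIgx : continuous (fun z : R * R => itvint 0 T (fun t => gx t z.1 z.2)) by cont.
have cIgy : continuous (fun z : R * R => itvint 0 T (fun t => gy t z.1 z.2)) by cont.
rewrite (boxintD _ _ _ _ cs0 (contD (contD cIg cIgx) cIgy)) lerD2l.
rewrite (boxintD _ _ _ _ (contD cIg cIgx) cIgy) (boxintD _ _ _ _ cIg cIgx).
have -> := f_equal2 +%R (f_equal2 +%R (erefl (boxint x0 x1 y0 y1
  (fun x y => itvint 0 T (fun t => g t x y)))) Igx) Igy.
by rewrite !addr0.
Qed.

Variables (c : R).
Hypotheses (c_ge : a ^+ 2 + m <= c) (c_ge1 : 1 <= c).

(** Completing the squares in each product of the flux costs [a ^+ 2 + m] on the displacement and 1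
    on the gradient part of the energy, whence the two lower bounds on [c]. *)
Lemma flux1_bound t x y :
  - (c * energy t x y) <= flux1 t x y <= c * energy t x y.
Proof.
have h (s : R) : s ^+ 2 = 1 -> 0 <= 2 * (c * energy t x y + s * flux1 t x y).
  move=> s1; rewrite /energy /flux1.
  set P := p t x y; set Q := q t x y; set A := Px t x y; set B := Py t x y.
  set C := Qx t x y; set D := Qy t x y.
  (* Sum of squares for both signs [s = 1] and [s = -1]; the last line of the identity carries the
     factor [1 - s ^+ 2]. *)
  have -> : 2 * (c * (2^-1 * (P ^+ 2 + Q ^+ 2) +
       2^-1 * (a ^+ 2 * (A ^+ 2 + B ^+ 2 + C ^+ 2 + D ^+ 2)) +
       2^-1 * (m * (A + D) ^+ 2)) +
     s * (P * (a ^+ 2 * A + m * (A + D)) + Q * (a ^+ 2 * C))) =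
    (c - (a ^+ 2 + m)) * (P ^+ 2 + Q ^+ 2) +
    (c - 1) * (a ^+ 2 * (A ^+ 2 + B ^+ 2 + C ^+ 2 + D ^+ 2) + m * (A + D) ^+ 2) +
    a ^+ 2 * ((s * P + A) ^+ 2 + (s * Q + C) ^+ 2 + B ^+ 2 + D ^+ 2) +
    m * ((s * P + (A + D)) ^+ 2 + Q ^+ 2) +
    (1 - s ^+ 2) * ((a ^+ 2 + m) * P ^+ 2 + a ^+ 2 * Q ^+ 2) by field.
  rewrite s1 subrr mul0r addr0.
  by do ![apply: sqr_ge0|apply: m0|rewrite subr_ge0//|apply: addr_ge0|apply: mulr_ge0].
have := h 1 (expr1n _ 2); have := h (-1) (etrans (sqrrN 1) (expr1n _ 2)).
rewrite !pmulr_rge0// mulN1r mul1r subr_ge0 => -> ; rewrite andbT.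
by rewrite -lerBlDl sub0r.
Qed.

Lemma flux2_bound t x y :
  - (c * energy t x y) <= flux2 t x y <= c * energy t x y.
Proof.
have h (s : R) : s ^+ 2 = 1 -> 0 <= 2 * (c * energy t x y + s * flux2 t x y).
  move=> s1; rewrite /energy /flux2.
  set P := p t x y; set Q := q t x y; set A := Px t x y; set B := Py t x y.
  set C := Qx t x y; set D := Qy t x y.
  have -> : 2 * (c * (2^-1 * (P ^+ 2 + Q ^+ 2) +
       2^-1 * (a ^+ 2 * (A ^+ 2 + B ^+ 2 + C ^+ 2 + D ^+ 2)) +
       2^-1 * (m * (A + D) ^+ 2)) +
     s * (P * (a ^+ 2 * B) + Q * (a ^+ 2 * D + m * (A + D)))) =
    (c - (a ^+ 2 + m)) * (P ^+ 2 + Q ^+ 2) +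
    (c - 1) * (a ^+ 2 * (A ^+ 2 + B ^+ 2 + C ^+ 2 + D ^+ 2) + m * (A + D) ^+ 2) +
    a ^+ 2 * ((s * P + B) ^+ 2 + (s * Q + D) ^+ 2 + A ^+ 2 + C ^+ 2) +
    m * ((s * Q + (A + D)) ^+ 2 + P ^+ 2) +
    (1 - s ^+ 2) * ((a ^+ 2 + m) * Q ^+ 2 + a ^+ 2 * P ^+ 2) by field.
  rewrite s1 subrr mul0r addr0.
  by do ![apply: sqr_ge0|apply: m0|rewrite subr_ge0//|apply: addr_ge0|apply: mulr_ge0].
have := h 1 (expr1n _ 2); have := h (-1) (etrans (sqrrN 1) (expr1n _ 2)).
rewrite !pmulr_rge0// mulN1r mul1r subr_ge0 => -> ; rewrite andbT.
by rewrite -lerBlDl sub0r.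
Qed.

Section cone.
Variables (x0 y0 r : R).

(** A weight that is positive exactly in the open square of half-side [r - c * t] around [(x0, y0)]:
    one factor for each side, which moves inwards at speed [c]. *)
Let cone t x y : R := sqpos (r - c * t + (x - x0)) * sqpos (r - c * t - (x - x0)) *
  (sqpos (r - c * t + (y - y0)) * sqpos (r - c * t - (y - y0))).

Let cone_out t x y : 0 <= t -> ~~ ((`|x - x0| < r) && (`|y - y0| < r)) ->
  cone t x y = 0.
Proof.
move=> t0; have ct0 : 0 <= c * t by rewrite mulr_ge0// (le_trans _ c_ge1).
have s0 (z : R) : r <= `|z| ->
    sqpos (r - c * t + z) * sqpos (r - c * t - z) = 0.
  rewrite ler_normr => /orP[h|h].
    by rewrite [X in _ * X]sqpos_eq0 ?mulr0//; lra.
  by rewrite [X in X * _]sqpos_eq0 ?mul0r//; lra.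
rewrite negb_and -!leNgt /cone => /orP[/s0 ->|/s0 ->].
  by rewrite mul0r.
by rewrite mulr0.
Qed.

(** The data and the source vanish wherever [cone] does not, so the weighted energy at time [T] has
    integral at most 0, hence vanishes at the centre, where the weight is still positive because
    [c * T < r]. *)
Lemma finite_propagation T : 0 <= T -> c * T < r ->
  (forall x y, Px 0 x y = 0 /\ Py 0 x y = 0) ->
  (forall x y, Qx 0 x y = 0 /\ Qy 0 x y = 0) ->
  (forall x y, `|x - x0| < r -> `|y - y0| < r -> p 0 x y = 0 /\ q 0 x y = 0) ->
  (forall x y, `|x - x0| < r -> `|y - y0| < r -> p1 x y = 0 /\ q1 x y = 0) ->
  p T x0 y0 = 0 /\ q T x0 y0 = 0.
Proof.
move=> T0 cTr P0 Q0 d0 d1.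
have cc : 0 < c by exact: lt_le_trans c_ge1.
have r0 : 0 < r by rewrite (le_lt_trans _ cTr)// mulr_ge0// ltW.
have cs := @cont_sqpos R.
have cE := cont_energy.
pose l1 t x := r - c * t + (x - x0).
pose l2 t x := r - c * t - (x - x0).
pose l3 t y := r - c * t + (y - y0).
pose l4 t y := r - c * t - (y - y0).
pose A1 t x y := 2 * Num.max 0 (l1 t x) * sqpos (l2 t x) * (sqpos (l3 t y) * sqpos (l4 t y)).
pose A2 t x y := sqpos (l1 t x) * (2 * Num.max 0 (l2 t x)) * (sqpos (l3 t y) * sqpos (l4 t y)).
pose A3 t x y := sqpos (l1 t x) * sqpos (l2 t x) * (2 * Num.max 0 (l3 t y) * sqpos (l4 t y)).
pose A4 t x y := sqpos (l1 t x) * sqpos (l2 t x) * (sqpos (l3 t y) * (2 * Num.max 0 (l4 t y))).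
have A_ge0 t x y : [/\ 0 <= A1 t x y, 0 <= A2 t x y, 0 <= A3 t x y & 0 <= A4 t x y].
  have mx (z : R) : 0 <= Num.max 0 z by rewrite le_max lexx.
  by split; do ![exact: mx|exact: sqpos_ge0|exact: ler0n|apply: mulr_ge0].
have ccone : cont3 cone by rewrite /cone; cont.
have cA1 : cont3 A1 by rewrite /A1 /l1 /l2 /l3 /l4; cont.
have cA2 : cont3 A2 by rewrite /A2 /l1 /l2 /l3 /l4; cont.
have cA3 : cont3 A3 by rewrite /A3 /l1 /l2 /l3 /l4; cont.
have cA4 : cont3 A4 by rewrite /A4 /l1 /l2 /l3 /l4; cont.
have dct (t x y : R) : is_derive t 1 (fun t => cone t x y)
    (- c * (A1 t x y + A2 t x y + A3 t x y + A4 t x y)).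
  rewrite /cone; eapply der_eq; [der|].
  rewrite /A1 /A2 /A3 /A4 /l1 /l2 /l3 /l4; ring.
have dcx (t x y : R) : is_derive x 1 (fun x => cone t x y) (A1 t x y - A2 t x y).
  rewrite /cone; eapply der_eq; [der|].
  rewrite /A1 /A2 /A3 /A4 /l1 /l2 /l3 /l4; ring.
have dcy (t x y : R) : is_derive y 1 (fun y => cone t x y) (A3 t x y - A4 t x y).
  rewrite /cone; eapply der_eq; [der|].
  rewrite /A1 /A2 /A3 /A4 /l1 /l2 /l3 /l4; ring.
have edge (z : R) : ~~ (`|z + r - z| < r) /\ ~~ (`|z - r - z| < r).
  by rewrite [z + r]addrC [z - r]addrC !addrK normrN gtr0_norm// ltxx.
have I0 : boxint (x0 - r) (x0 + r) (y0 - r) (y0 + r)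
    (fun x y => cone T x y * energy T x y) <= 0.
  have h0 : boxint (x0 - r) (x0 + r) (y0 - r) (y0 + r)
      (fun x y => cone 0 x y * energy 0 x y) = 0.
    rewrite (@eq_boxint _ _ _ _ _ _ (fun _ _ => 0)); first by rewrite boxint_cst ?mul0r//; lra.
    move=> x y _ _; have [/andP[xr yr]|] := boolP ((`|x - x0| < r) && (`|y - y0| < r)).
      have [p0 q0] := d0 x y xr yr; have [Px0 Py0] := P0 x y; have [Qx0 Qy0] := Q0 x y.
      by rewrite /energy p0 q0 Px0 Py0 Qx0 Qy0 !(addr0, mulr0, expr0n).
    by move=> h; rewrite (cone_out (lexx 0) h) mul0r.
  have h1 : boxint (x0 - r) (x0 + r) (y0 - r) (y0 + r) (fun x y => itvint 0 T (fun t =>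
      cone t x y * (p1 x y * p t x y + q1 x y * q t x y))) = 0.
    rewrite (@eq_boxint _ _ _ _ _ _ (fun _ _ => 0)); first by rewrite boxint_cst ?mul0r//; lra.
    move=> x y _ _; rewrite -[RHS](mul0r (T - 0)) -(itvint_cst 0 T0).
    apply: itvint_eq => t /andP[t0 _].
    have [/andP[xr yr]|] := boolP ((`|x - x0| < r) && (`|y - y0| < r)).
      by have [-> ->] := d1 x y xr yr; rewrite !mul0r addr0 mulr0.
    by move=> h; rewrite (cone_out t0 h) mul0r.
  rewrite -[leRHS]addr0 -[X in _ <= X + _]h0 -[X in _ <= _ + X]h1.
  apply: (weighted_energy_le T0 _ _ ccone _ _ _ dct dcx dcy).
  - by rewrite lerD2l ge0_cp// ltW.
  - by rewrite lerD2l ge0_cp// ltW.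
  - by cont.
  - by cont.
  - by cont.
  - move=> t x y _; have [a1 a2 a3 a4] := A_ge0 t x y.
    have /andP[f1 f2] := flux1_bound t x y; have /andP[g1 g2] := flux2_bound t x y.
    move: a1 a2 a3 a4 f1 f2 g1 g2; move: (A1 t x y) (A2 t x y) (A3 t x y) (A4 t x y).
    move: (flux1 t x y) (flux2 t x y) (energy t x y).
    move=> F G E B1 B2 B3 B4 b1 b2 b3 b4 f1 f2 g1 g2.
    (* Each side of the square loses at least the energy that flows through it: one of these four
       products per side, and their sum is the required inequality. *)
    have k1 : 0 <= B1 * (c * E + F) by rewrite mulr_ge0// -lerBlDl sub0r.
    have k2 : 0 <= B2 * (c * E - F) by rewrite mulr_ge0// subr_ge0.
    have k3 : 0 <= B3 * (c * E + G) by rewrite mulr_ge0// -lerBlDl sub0r.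
    have k4 : 0 <= B4 * (c * E - G) by rewrite mulr_ge0// subr_ge0.
    rewrite -subr_ge0.
    rewrite (_ : _ - _ = B1 * (c * E + F) + B2 * (c * E - F) + B3 * (c * E + G)
      + B4 * (c * E - G)); last by ring.
    by do ![assumption|apply: addr_ge0].
  - move=> t y /andP[t0 _]; have [e1 e2] := edge x0.
    have k z : ~~ (`|z - x0| < r) -> cone t z y * flux1 t z y = 0.
      by move=> h; rewrite cone_out ?mul0r// negb_and h.
    by split; apply: k.
  - move=> t x /andP[t0 _]; have [e1 e2] := edge y0.
    have k z : ~~ (`|z - y0| < r) -> cone t x z * flux2 t x z = 0.
      by move=> h; rewrite cone_out ?mul0r// negb_and h orbT.
    by split; apply: k.
have ccE : continuous (fun z : R * R => cone T z.1 z.2 * energy T z.1 z.2) by cont.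
have cE0 x y : 0 <= cone T x y * energy T x y.
  by rewrite /cone; do ![exact: sqpos_ge0|exact: energy_ge0|apply: mulr_ge0].
have hx : x0 - r < x0 < x0 + r by lra.
have hy : y0 - r < y0 < y0 + r by lra.
have /eqP := boxint_le0_eq0 ccE cE0 I0 hx hy.
rewrite mulf_eq0 => /orP[|].
  suff cone_gt0 : 0 < cone T x0 y0 by rewrite gt_eqF.
  have cTr' : 0 < r - c * T by rewrite subr_gt0.
  rewrite /cone !subrr !addr0 !subr0 /sqpos max_r; last exact: ltW.
  by do ![exact: exprn_gt0|apply: mulr_gt0].
rewrite /energy => /eqP E0.
have s0 : 0 <= a ^+ 2 * (Px T x0 y0 ^+ 2 + Py T x0 y0 ^+ 2 + Qx T x0 y0 ^+ 2 + Qy T x0 y0 ^+ 2).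
  by do ![apply: sqr_ge0|apply: m0|apply: addr_ge0|apply: mulr_ge0].
have s1 : 0 <= m * (Px T x0 y0 + Qy T x0 y0) ^+ 2.
  by do ![apply: sqr_ge0|apply: m0|apply: addr_ge0|apply: mulr_ge0].
have pq : p T x0 y0 ^+ 2 + q T x0 y0 ^+ 2 = 0.
  apply/eqP; rewrite eq_le addr_ge0 ?sqr_ge0// andbT.
  move: E0 s0 s1; lra.
move/eqP: pq; rewrite paddr_eq0 ?sqr_ge0// !sqrf_eq0 => /andP[/eqP -> /eqP ->].
by [].
Qed.
End cone.

Variable (L : R).
Hypotheses (Px0 : forall x y, Px 0 x y = 0) (Py0 : forall x y, Py 0 x y = 0)
  (Qx0 : forall x y, Qx 0 x y = 0) (Qy0 : forall x y, Qy 0 x y = 0).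
Hypotheses
  (data0 : forall x y, L < `|x| \/ L < `|y| -> p 0 x y = 0 /\ q 0 x y = 0)
  (data1 : forall x y, L < `|x| \/ L < `|y| -> p1 x y = 0 /\ q1 x y = 0).

(** The square of half-side [|x| - L], or [|y| - L], around [(x, y)] misses the support of the
    data. *)
Lemma vanish_outside t x y : 0 <= t ->
  L + c * t < `|x| \/ L + c * t < `|y| -> p t x y = 0 /\ q t x y = 0.
Proof.
have far (z z' : R) : `|z' - z| < `|z| - L -> L < `|z'|.
  move=> h; have := ler_normB z' (z' - z); rewrite opprB addrC subrK; lra.
have P0 : forall x y, Px 0 x y = 0 /\ Py 0 x y = 0 by [].
have Q0 : forall x y, Qx 0 x y = 0 /\ Qy 0 x y = 0 by [].
move=> t0 [h|h].
  apply: (@finite_propagation x y (`|x| - L) t) => //; first by rewrite ltrBrDl.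
    by move=> x' y' /far hx _; apply: data0; left.
  by move=> x' y' /far hx _; apply: data1; left.
apply: (@finite_propagation x y (`|y| - L) t) => //; first by rewrite ltrBrDl.
  by move=> x' y' _ /far hy; apply: data0; right.
by move=> x' y' _ /far hy; apply: data1; right.
Qed.

(** Here the weight is 1; the flux vanishes on the boundary because the displacement has not reached
    it by time [T]. *)
Lemma energy_le T rho : 0 <= T -> 0 <= rho -> L + c * T < rho ->
  boxint (- rho) rho (- rho) rho (energy T) <=
  boxint (- rho) rho (- rho) rho (fun x y => 2^-1 * (p 0 x y ^+ 2 + q 0 x y ^+ 2)) +
  boxint (- rho) rho (- rho) rho (fun x y => itvint 0 T (fun t =>
    p1 x y * p t x y + q1 x y * q t x y)).
Proof.
move=> T0 rho0 rhoT.
have rr : - rho <= rho by rewrite ge0_cp.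
have cE := cont_energy.
have c1 : cont3 (fun _ _ _ : R => 1 : R) by cont.
have c0 : cont3 (fun _ _ _ : R => 0 : R) by cont.
have cc : 0 <= c by exact: le_trans c_ge1.
have late t : 0 <= t <= T -> 0 <= t /\ L + c * t < rho.
  move=> /andP[t0 tT]; split => //; apply: le_lt_trans rhoT.
  by rewrite lerD2l ler_wpM2l.
have := weighted_energy_le T0 rr rr c1 c0 c0 c0
  (fun t _ _ => der_cst 1 t) (fun _ x _ => der_cst 1 x) (fun _ _ y => der_cst 1 y).
have -> : boxint (- rho) rho (- rho) rho (fun x y => 1 * energy T x y) =
    boxint (- rho) rho (- rho) rho (energy T).
  by apply: eq_boxint => x y _ _; rewrite mul1r.
have -> : boxint (- rho) rho (- rho) rho (fun x y => 1 * energy 0 x y) =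
    boxint (- rho) rho (- rho) rho (fun x y => 2^-1 * (p 0 x y ^+ 2 + q 0 x y ^+ 2)).
  apply: eq_boxint => x y _ _.
  by rewrite /energy Px0 Py0 Qx0 Qy0 mul1r !(addr0, mulr0, expr0n).
have -> : boxint (- rho) rho (- rho) rho (fun x y => itvint 0 T (fun t =>
      1 * (p1 x y * p t x y + q1 x y * q t x y))) =
    boxint (- rho) rho (- rho) rho (fun x y => itvint 0 T (fun t =>
      p1 x y * p t x y + q1 x y * q t x y)).
  by apply: eq_boxint => x y _ _; apply: itvint_eq => t _; rewrite mul1r.
apply.
- by move=> t x y _; rewrite !mul0r addr0.
- move=> t y /late[t0 ht]; rewrite /flux1 !mul1r.
  have e1 : L + c * t < `|rho| by rewrite ger0_norm.
  have e2 : L + c * t < `|- rho| by rewrite normrN.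
  have [-> ->] := vanish_outside t0 (or_introl (L + c * t < `|y|) e1).
  have [-> ->] := vanish_outside t0 (or_introl (L + c * t < `|y|) e2).
  by rewrite !mul0r addr0.
- move=> t x /late[t0 ht]; rewrite /flux2 !mul1r.
  have e1 : L + c * t < `|rho| by rewrite ger0_norm.
  have e2 : L + c * t < `|- rho| by rewrite normrN.
  have [-> ->] := vanish_outside t0 (or_intror (L + c * t < `|x|) e1).
  have [-> ->] := vanish_outside t0 (or_intror (L + c * t < `|x|) e2).
  by rewrite !mul0r addr0.
Qed.

End energy.

(** * Estimate on a box *)

Section support.
Context {R : realType}.

Lemma itvint_support (a b c d : R) (f : R -> R) : c <= a -> b <= d ->
  (forall x, ~~ (a <= x <= b) -> f x = 0) -> itvint c d f = itvint a b f.
Proof.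
move=> ca bd f0; rewrite /itvint Rintegral_mkcond [RHS]Rintegral_mkcond.
apply: eq_Rintegral => x _; rewrite !patchE !mem_setE !in_itv/=.
have [/andP[ax xb]|/f0 ->] := boolP (a <= x <= b); last by case: ifP.
by rewrite (le_trans ca ax) (le_trans xb bd).
Qed.

Lemma boxint_support (L rho : R) (F : R -> R -> R) : L <= rho ->
  (forall x y, L < `|x| \/ L < `|y| -> F x y = 0) ->
  boxint (- rho) rho (- rho) rho F = boxint (- L) L (- L) L F.
Proof.
move=> Lr F0.
have far (z : R) : ~~ (- L <= z <= L) -> L < `|z|.
  by move=> h; rewrite ltNge; apply: contra h; rewrite ler_norml.
have NLr : - rho <= - L by rewrite lerN2.
rewrite /boxint (itvint_support NLr Lr).
  apply: itvint_eq => x _; apply: itvint_support => // y /far hy.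
  by apply: F0; right.
move=> x /far hx; rewrite (@itvint_eq _ _ _ _ (fun=> 0)).
  by rewrite /itvint Rintegral_cst//= mul0r.
by move=> y _; apply: F0; left.
Qed.
End support.

Section box_estimate.
Context {R : realType}.
Variables (a m c L : R) (p q pt qt px py qx qy : R -> R -> R -> R).
Variables (pxx pxy pyy qxx qyx qyy : R -> R -> R -> R).
Notation cont3 f := (continuous (fun z : R * (R * R) => f z.1 z.2.1 z.2.2)).
Hypotheses (a0 : 0 < a) (m0 : 0 <= m) (c_ge : a ^+ 2 + m <= c) (c_ge1 : 1 <= c)
  (L0 : 0 < L).
Hypotheses
  (cp : cont3 p) (cq : cont3 q) (cpt : cont3 pt) (cqt : cont3 qt)
  (cpx : cont3 px) (cpy : cont3 py) (cqx : cont3 qx) (cqy : cont3 qy)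
  (cpxx : cont3 pxx) (cpxy : cont3 pxy) (cpyy : cont3 pyy)
  (cqxx : cont3 qxx) (cqyx : cont3 qyx) (cqyy : cont3 qyy).
Hypotheses
  (dpt : forall t x y : R, is_derive t 1 (fun t => p t x y) (pt t x y))
  (dqt : forall t x y : R, is_derive t 1 (fun t => q t x y) (qt t x y))
  (dpx : forall t x y : R, is_derive x 1 (fun x => p t x y) (px t x y))
  (dqx : forall t x y : R, is_derive x 1 (fun x => q t x y) (qx t x y))
  (dpy : forall t x y : R, is_derive y 1 (fun y => p t x y) (py t x y))
  (dqy : forall t x y : R, is_derive y 1 (fun y => q t x y) (qy t x y))
  (dpxx : forall t x y : R, is_derive x 1 (fun x => px t x y) (pxx t x y))
  (dpxy : forall t x y : R, is_derive y 1 (fun y => px t x y) (pxy t x y))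
  (dpyy : forall t x y : R, is_derive y 1 (fun y => py t x y) (pyy t x y))
  (dqxx : forall t x y : R, is_derive x 1 (fun x => qx t x y) (qxx t x y))
  (dqyx : forall t x y : R, is_derive x 1 (fun x => qy t x y) (qyx t x y))
  (dqyy : forall t x y : R, is_derive y 1 (fun y => qy t x y) (qyy t x y)).
Hypotheses
  (pde1 : forall t x y : R, 0 < t -> is_derive t 1 (fun t => pt t x y)
     (a ^+ 2 * (pxx t x y + pyy t x y) + m * (pxx t x y + qyx t x y)))
  (pde2 : forall t x y : R, 0 < t -> is_derive t 1 (fun t => qt t x y)
     (a ^+ 2 * (qxx t x y + qyy t x y) + m * (pxy t x y + qyy t x y))).
Hypotheses
  (data0 : forall x y, L < `|x| \/ L < `|y| -> p 0 x y = 0 /\ q 0 x y = 0)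
  (data1 : forall x y, L < `|x| \/ L < `|y| -> pt 0 x y = 0 /\ qt 0 x y = 0).

(** Applied to the first time derivative of each component, this yields the equation of v, with the
    initial velocity as a source constant in time. *)
Let integrated (h f1 f2 f3 : R -> R -> R -> R) t x y : 0 <= t -> cont3 h ->
  cont3 f1 -> cont3 f2 -> cont3 f3 ->
  (forall t : R, 0 < t -> is_derive t 1 (fun t => h t x y)
     (a ^+ 2 * (f1 t x y + f2 t x y) + m * (f3 t x y))) ->
  h t x y = h 0 x y + a ^+ 2 * (tint f1 t x y + tint f2 t x y) + m * tint f3 t x y.
Proof.
move=> t0 ch c1 c2 c3 dh.
have chx : continuous (fun t => h t x y) by cont.
have dh' (s : R) : 0 < s < t -> is_derive s 1 (fun t => h t x y)
   (a ^+ 2 * (f1 s x y + f2 s x y) + m * (f3 s x y)).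
  by move=> /andP[s0 _]; exact: dh.
have := itvint_FTC2 t0 _ (fun s _ => chx s) dh'.
rewrite itvintD; [|cont|cont].
rewrite itvintZ; [|cont]; rewrite itvintZ; [|cont]; rewrite itvintD; [|cont|cont].
rewrite -!tintE// => h'.
rewrite -addrA h'; last by cont.
by rewrite addrC subrK.
Qed.

Let p1 x y := pt 0 x y.
Let q1 x y := qt 0 x y.

Let cp1 : continuous (fun z : R * R => p1 z.1 z.2). Proof. by rewrite /p1; cont. Qed.
Let cq1 : continuous (fun z : R * R => q1 z.1 z.2). Proof. by rewrite /q1; cont. Qed.

Let eq_p t x y : 0 <= t -> pt t x y = p1 x y +
  a ^+ 2 * (tint pxx t x y + tint pyy t x y) + m * (tint pxx t x y + tint qyx t x y).
Proof.
move=> t0.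
have cs : cont3 (fun t x y => pxx t x y + qyx t x y) by cont.
have -> := @integrated pt pxx pyy (fun t x y => pxx t x y + qyx t x y) t x y t0 cpt cpxx cpyy cs (fun s => @pde1 s x y).
by rewrite !tintE// itvintD; [|cont|cont].
Qed.

Let eq_q t x y : 0 <= t -> qt t x y = q1 x y +
  a ^+ 2 * (tint qxx t x y + tint qyy t x y) + m * (tint pxy t x y + tint qyy t x y).
Proof.
move=> t0.
have cs : cont3 (fun t x y => pxy t x y + qyy t x y) by cont.
have -> := @integrated qt qxx qyy (fun t x y => pxy t x y + qyy t x y) t x y t0 cqt cqxx cqyy cs (fun s => @pde2 s x y).
by rewrite !tintE// itvintD; [|cont|cont].
Qed.

Let vanish := @vanish_outside R a m p q pt qt px py qx qy
  (tint px) (tint py) (tint qx) (tint qy)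
  (tint pxx) (tint pxy) (tint pyy) (tint qxx) (tint qyx) (tint qyy) p1 q1 m0
  cp cq cpt cqt cpx cpy cqx cqy
  (cont_tint cpx) (cont_tint cpy) (cont_tint cqx) (cont_tint cqy)
  (cont_tint cpxx) (cont_tint cpxy) (cont_tint cpyy)
  (cont_tint cqxx) (cont_tint cqyx) (cont_tint cqyy) cp1 cq1
  dpt dqt dpx dqx dpy dqy
  (fun t x y => @is_derive_tint R px t x y cpx)
  (fun t x y => @is_derive_tint R py t x y cpy)
  (fun t x y => @is_derive_tint R qx t x y cqx)
  (fun t x y => @is_derive_tint R qy t x y cqy)
  (fun t x y => is_derive_tint1 t x y cpx cpxx dpxx)
  (fun t x y => is_derive_tint2 t x y cpx cpxy dpxy)
  (fun t x y => is_derive_tint2 t x y cpy cpyy dpyy)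
  (fun t x y => is_derive_tint1 t x y cqx cqxx dqxx)
  (fun t x y => is_derive_tint1 t x y cqy cqyx dqyx)
  (fun t x y => is_derive_tint2 t x y cqy cqyy dqyy)
  eq_p eq_q c c_ge c_ge1 L
  (tint0 px) (tint0 py) (tint0 qx) (tint0 qy) data0 data1.
Let spec_energy := @energy_le R a m p q pt qt px py qx qy
  (tint px) (tint py) (tint qx) (tint qy)
  (tint pxx) (tint pxy) (tint pyy) (tint qxx) (tint qyx) (tint qyy) p1 q1 m0
  cp cq cpt cqt cpx cpy cqx cqy
  (cont_tint cpx) (cont_tint cpy) (cont_tint cqx) (cont_tint cqy)
  (cont_tint cpxx) (cont_tint cpxy) (cont_tint cpyy)
  (cont_tint cqxx) (cont_tint cqyx) (cont_tint cqyy) cp1 cq1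
  dpt dqt dpx dqx dpy dqy
  (fun t x y => @is_derive_tint R px t x y cpx)
  (fun t x y => @is_derive_tint R py t x y cpy)
  (fun t x y => @is_derive_tint R qx t x y cqx)
  (fun t x y => @is_derive_tint R qy t x y cqy)
  (fun t x y => is_derive_tint1 t x y cpx cpxx dpxx)
  (fun t x y => is_derive_tint2 t x y cpx cpxy dpxy)
  (fun t x y => is_derive_tint2 t x y cpy cpyy dpyy)
  (fun t x y => is_derive_tint1 t x y cqx cqxx dqxx)
  (fun t x y => is_derive_tint1 t x y cqy cqyx dqyx)
  (fun t x y => is_derive_tint2 t x y cqy cqyy dqyy)
  eq_p eq_q c c_ge c_ge1 L
  (tint0 px) (tint0 py) (tint0 qx) (tint0 qy) data0 data1.

Lemma finite_speed t x y : 0 <= t ->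
  L + c * t < `|x| \/ L + c * t < `|y| -> p t x y = 0 /\ q t x y = 0.
Proof. exact: vanish. Qed.

Let cu (f : R -> R -> R -> R) t : cont3 f -> continuous (fun z : R * R => f t z.1 z.2).
Proof. by move=> cf; cont. Qed.

Lemma box_estimate T rho (w : R -> R -> R) W : 0 <= T -> 2 * L <= rho ->
  L + c * T < rho ->
  continuous (fun z : R * R => w z.1 z.2) ->
  (forall x y, `|pt 0 x y| <= w x y /\ `|qt 0 x y| <= w x y) ->
  (forall x y, 0 <= w x y <= W) ->
  boxint (- rho) rho (- rho) rho (fun x y => p T x y ^+ 2 + q T x y ^+ 2) <=
  boxint (- rho) rho (- rho) rho (fun x y => p 0 x y ^+ 2 + q 0 x y ^+ 2) +
  384 * L ^+ 4 / a ^+ 2 * W ^+ 2 +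
  8 / a ^+ 2 * (boxint (- L) L (- L) L w ^+ 2 * (ln rho - ln L)).
Proof.
move=> T0 Lrho rhoT cw pqw wW.
have cL : 0 <= L := ltW L0.
have L2 : L <= 2 * L by rewrite ler_peMl// ler1n.
have Lr : L <= rho := le_trans L2 Lrho.
have r0 : 0 <= rho := le_trans cL Lr.
have a2 : 0 < a ^+ 2 by rewrite exprn_gt0.
pose P := tint p T; pose Q := tint q T.
have cP : continuous (fun z : R * R => P z.1 z.2) := @cu (tint p) T (cont_tint cp).
have cQ : continuous (fun z : R * R => Q z.1 z.2) := @cu (tint q) T (cont_tint cq).
have cPx := @cu (tint px) T (cont_tint cpx); have cPy := @cu (tint py) T (cont_tint cpy).
have cQx := @cu (tint qx) T (cont_tint cqx); have cQy := @cu (tint qy) T (cont_tint cqy).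
have bd y : P rho y = 0 /\ Q rho y = 0.
  have h t : 0 <= t <= T -> p t rho y = 0 /\ q t rho y = 0.
    move=> /andP[t0 tT]; apply: vanish => //; left; rewrite ger0_norm//.
    apply: le_lt_trans rhoT; rewrite lerD2l ler_wpM2l//.
    exact: le_trans c_ge1.
  rewrite /P /Q !tintE//; split; rewrite -[RHS](mul0r (T - 0)) -(itvint_cst 0 T0).
    by apply: itvint_eq => t /h[].
  by apply: itvint_eq => t /h[].
(* With this [e] the factor [2 * e] of the Poincare inequality is [a ^+ 2 / 2], the coefficient of
   the squared gradient in the energy. *)
have e0 : 0 < a ^+ 2 / 4 by rewrite divr_gt0.
have poinP := log_poincare L0 Lrho e0 cP cPx cPy cw
  (fun x y => is_derive_tint1 T x y cp cpx dpx)
  (fun x y => is_derive_tint2 T x y cp cpy dpy) (fun y => (bd y).1) wW.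
have poinQ := log_poincare L0 Lrho e0 cQ cQx cQy cw
  (fun x y => is_derive_tint1 T x y cq cqx dqx)
  (fun x y => is_derive_tint2 T x y cq cqy dqy) (fun y => (bd y).2) wW.
have en := spec_energy T0 r0 rhoT.
(* The source does not depend on time, so its product with the displacement integrates in time to
   the source times [P] or [Q]; its support reduces the square to half-side [L]. *)
have cross : boxint (- rho) rho (- rho) rho (fun x y => itvint 0 T (fun t =>
      p1 x y * p t x y + q1 x y * q t x y)) <=
    boxint (- L) L (- L) L (fun x y => w x y * `|P x y|) +
    boxint (- L) L (- L) L (fun x y => w x y * `|Q x y|).
  rewrite (boxint_support Lr); last first.
    move=> x y hxy; rewrite -[RHS](mul0r (T - 0)) -(itvint_cst 0 T0).
    by apply: itvint_eq => t _; rewrite /p1 /q1; have [-> ->] := data1 hxy;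
      rewrite !mul0r addr0.
  rewrite -boxintD; [|cont|cont].
  apply: le_boxint; [cont|cont|move=> x y _ _].
  rewrite itvintD; [|cont|cont]; rewrite itvintZ; [|cont]; rewrite itvintZ; [|cont].
  rewrite -!tintE//; apply: lerD.
    by apply: le_trans (ler_norm _) _; rewrite normrM ler_wpM2r// (pqw x y).1.
  by apply: le_trans (ler_norm _) _; rewrite normrM ler_wpM2r// (pqw x y).2.
(* The nonnegative term with the factor [m] is discarded. *)
have lower : 2^-1 * boxint (- rho) rho (- rho) rho (fun x y => p T x y ^+ 2 + q T x y ^+ 2)
   + 2^-1 * a ^+ 2 * ((boxint (- rho) rho (- rho) rho (fun x y => tint px T x y ^+ 2) +
           boxint (- rho) rho (- rho) rho (fun x y => tint py T x y ^+ 2)) +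
         (boxint (- rho) rho (- rho) rho (fun x y => tint qx T x y ^+ 2) +
           boxint (- rho) rho (- rho) rho (fun x y => tint qy T x y ^+ 2))) <=
   boxint (- rho) rho (- rho) rho (energy a m p q (tint px) (tint py) (tint qx) (tint qy) T).
  pose fu x y := p T x y ^+ 2 + q T x y ^+ 2.
  pose f1 x y := tint px T x y ^+ 2; pose f2 x y := tint py T x y ^+ 2.
  pose f3 x y := tint qx T x y ^+ 2; pose f4 x y := tint qy T x y ^+ 2.
  have cf1 : continuous (fun z : R * R => f1 z.1 z.2) by rewrite /f1; cont.
  have cf2 : continuous (fun z : R * R => f2 z.1 z.2) by rewrite /f2; cont.
  have cf3 : continuous (fun z : R * R => f3 z.1 z.2) by rewrite /f3; cont.
  have cf4 : continuous (fun z : R * R => f4 z.1 z.2) by rewrite /f4; cont.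
  have cfu : continuous (fun z : R * R => fu z.1 z.2) by rewrite /fu; cont.
  have cV : continuous (fun z : R * R =>
    (f1 z.1 z.2 + f2 z.1 z.2) + (f3 z.1 z.2 + f4 z.1 z.2)) by cont.
  apply: (@le_trans _ _ (boxint (- rho) rho (- rho) rho (fun x y =>
      2^-1 * fu x y + 2^-1 * a ^+ 2 * ((f1 x y + f2 x y) + (f3 x y + f4 x y))))).
    rewrite -/fu -/f1 -/f2 -/f3 -/f4.
    have := boxintD (- rho) rho (- rho) rho; have := boxintZ (- rho) rho (- rho) rho.
    move: (boxint (- rho) rho (- rho) rho) => B BZ BD.
    rewrite (BD (fun x y => 2^-1 * fu x y) (fun x y => 2^-1 * a ^+ 2 *
      ((f1 x y + f2 x y) + (f3 x y + f4 x y)))); [|cont|cont].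
    rewrite (BZ _ fu cfu) (BZ _ (fun x y => (f1 x y + f2 x y) + (f3 x y + f4 x y)) cV).
    rewrite (BD (fun x y => f1 x y + f2 x y) (fun x y => f3 x y + f4 x y)); [|cont|cont].
    by rewrite (BD f1 f2 cf1 cf2) (BD f3 f4 cf3 cf4).
  have cE := @cont_energy R a m p q _ _ _ _ cp cq (cont_tint cpx) (cont_tint cpy)
    (cont_tint cqx) (cont_tint cqy).
  apply: le_boxint; [cont|by cont|move=> x y _ _].
  rewrite /fu /f1 /f2 /f3 /f4.
  by rewrite /energy -!mulrA !addrA lerDl mulr_ge0// ?invr_ge0// mulr_ge0// sqr_ge0.
have cu0 : continuous (fun z : R * R => p 0 z.1 z.2 ^+ 2 + q 0 z.1 z.2 ^+ 2) by cont.
rewrite (boxintZ _ _ _ _ _ cu0) in en.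
have {lower en cross} total := le_trans lower (le_trans en (lerD (lexx _)
  (le_trans cross (lerD poinP poinQ)))).
move: total {poinP poinQ}; rewrite -/P -/Q.
move: (boxint _ _ _ _ (fun x y => p T x y ^+ 2 + q T x y ^+ 2)) => U.
move: (boxint _ _ _ _ (fun x y => p 0 x y ^+ 2 + q 0 x y ^+ 2)) => U0.
move: (boxint _ _ _ _ (fun x y => tint px T x y ^+ 2)) => Gpx.
move: (boxint _ _ _ _ (fun x y => tint py T x y ^+ 2)) => Gpy.
move: (boxint _ _ _ _ (fun x y => tint qx T x y ^+ 2)) => Gqx.
move: (boxint _ _ _ _ (fun x y => tint qy T x y ^+ 2)) => Gqy.
move: (boxint _ _ _ _ w) (ln rho - ln L) => M l total.
rewrite -(ler_pM2l (_ : 0 < 2^-1 :> R)) ?invr_gt0//.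
rewrite -(lerD2r (2^-1 * a ^+ 2 * (Gpx + Gpy + (Gqx + Gqy)))).
apply: le_trans total _; rewrite le_eqVlt; apply/orP; left; apply/eqP.
by field; rewrite gt_eqF.
Qed.
End box_estimate.

(** * Lebesgue measure on the plane *)

Section plane_measure.
Context {R : realType}.
Local Notation RR := (measurableTypeR R * measurableTypeR R)%type.

Let rect (i : rat * rat * nat) : set (R * R) :=
  (ball (ratr i.1.1 : R) (i.2.+1%:R^-1 : R)) `*` (ball (ratr i.1.2 : R) (i.2.+1%:R^-1 : R)).

(** An open set is the union of the countably many squares with rational centre and half-side
    [1 / (k + 1)] that it contains. *)
Lemma open_measurable2 (U : set (R * R)) : open U -> measurable (U : set RR).
Proof.
move=> oU.
have -> : U = \bigcup_i (if `[< rect i `<=` U >] then rect i else set0).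
  apply/seteqP; split => [[x y] Uxy|z [i _]]; last by case: asboolP => // iU; exact: iU.
  have /nbhs_ballP[e /= e0 eU] : nbhs (x, y) U by apply: open_nbhs_nbhs.
  have [k] : exists k : nat, 0 + k.+1%:R^-1 < e / 2.
    by apply: ltr_add_invr; rewrite divr_gt0.
  rewrite add0r => ke; set d : R := k.+1%:R^-1 in ke *.
  have d0 : 0 < d by rewrite invr_gt0.
  have rat_near (z : R) : exists q : rat, `|ratr q - z| < d.
    have [q] : exists q : rat, ratr q \in `](z - d), (z + d)[.
      by apply: rat_in_itvoo; rewrite ltrBlDr -addrA ltrDl addr_gt0.
    by rewrite in_itv/= -ltr_distl => hq; exists q.
  have [q1 hq1] := rat_near x; have [q2 hq2] := rat_near y.
  exists (q1, q2, k) => //; case: asboolP => [_|]; first by split.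
  case=> -[x' y'] [/=]; rewrite /ball/= -/d => h1 h2.
  have tri (z z' q : R) : `|q - z| < d -> `|q - z'| < d -> ball z e z'.
    move=> h h'; rewrite /ball/= (le_lt_trans (ler_distD q _ _))//.
    by rewrite [e]splitr ltrD//; [rewrite distrC; exact: lt_trans h ke|exact: lt_trans h' ke].
  by apply: eU; split; apply: tri; eassumption.
apply: countable_bigcupT_measurable => // i; case: asboolP => // _.
by apply: measurableX; exact: measurable_ball.
Qed.

Lemma continuous_measurable2 (f : R * R -> R) : continuous f ->
  measurable_fun [set: RR] (f : RR -> R).
Proof.
move=> /continuousP cf; apply: (measurability _ (RGenOpens.measurableE R)).
move=> _ [_ [a [b ->] <-]]; rewrite setTI; apply: open_measurable2.
exact/cf/interval_open.
Qed.

Lemma integral_itvint (a b : R) (f : R -> R) : continuous f ->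
  (forall x, ~~ (a <= x <= b) -> f x = 0) ->
  (\int[lebesgue_measure]_x (f x)%:E)%E = (itvint a b f)%:E.
Proof.
move=> cf f0; rewrite -itvintE// [RHS]integral_mkcond.
apply: eq_integral => x _; rewrite patchE mem_setE in_itv/=.
by case: ifPn => // /f0 ->.
Qed.

Lemma integral_boxint (rho : R) (f : R * R -> R) : continuous f ->
  (forall z, 0 <= f z) ->
  (forall x y, rho < `|x| \/ rho < `|y| -> f (x, y) = 0) ->
  (\int[lebesgue2]_z (f z)%:E)%E =
  (boxint (- rho) rho (- rho) rho (fun x y => f (x, y)))%:E.
Proof.
move=> cf f_ge0 f0.
have cf2 : continuous (fun z : R * R => (fun x y => f (x, y)) z.1 z.2).
  by apply: (cont_comp (g := f) (f := fun z : R * R => (z.1, z.2))) => //; cont.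
have far (z : R) : ~~ (- rho <= z <= rho) -> rho < `|z|.
  by move=> h; rewrite ltNge; apply: contra h; rewrite ler_norml.
have mf : measurable_fun [set: RR] (fun z : RR => (f z)%:E).
  by apply/measurable_EFinP; exact: continuous_measurable2.
have fE0 (z : RR) : (0 <= (f z)%:E)%E by rewrite lee_fin.
apply: etrans (@fubini_tonelli1 _ _ (measurableTypeR R) (measurableTypeR R) R
  lebesgue_measure lebesgue_measure (fun z : RR => (f z)%:E) mf fE0) _.
have cI : continuous (fun x => itvint (- rho) rho (fun y => f (x, y))).
  exact: (continuous_itvint (F := fun x y => f (x, y))).
have I0 x : ~~ (- rho <= x <= rho) -> itvint (- rho) rho (fun y => f (x, y)) = 0.
  move=> /far hx; rewrite (@itvint_eq _ _ _ _ (fun=> 0)).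
    by rewrite /itvint Rintegral_cst//= mul0r.
  by move=> y _; apply: f0; left.
rewrite /boxint -(integral_itvint cI I0).
have cfx (x : R) : continuous (fun y : R => f (x, y)).
  exact: (cont_comp2 (F := fun x y => f (x, y)) cf2 (@cont_cst _ _ x) (@cont_id _)).
apply: eq_integral => x _; apply: (integral_itvint (cfx x)).
by move=> y /far hy; apply: f0; right.
Qed.

Lemma lebesgue2_ball (z : R * R) (e : R) : 0 < e ->
  (0 < lebesgue2 (ball z.1 e `*` ball z.2 e))%E.
Proof.
move=> e0; have h := @product_measure1E _ _ (measurableTypeR R) (measurableTypeR R) R
  lebesgue_measure lebesgue_measure _ _ (measurable_ball z.1 e) (measurable_ball z.2 e).
suff : (0 < lebesgue_measure (ball z.1 e) * lebesgue_measure (ball z.2 e))%E.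
  by move: h => <-.
by rewrite !lebesgue_measure_ball ?ltW// -EFinM lte_fin mulr_gt0// pmulrn_lgt0.
Qed.

(** If [W < f z], continuity gives a square around [z] inside the exceptional null set, but squares
    have positive measure. *)
Lemma ess_sup_le (f : R * R -> R) (W : R) : continuous f ->
  (ess_sup lebesgue2 (fun z => (f z)%:E) <= W%:E)%E -> forall z, f z <= W.
Proof.
move=> cf /ess_supP [N [mN N0 subN]] z; rewrite leNgt; apply/negP => Wz.
have : nbhs z [set w | W < f w].
  have := cf z => /cvgrPdist_lt/(_ (f z - W)); rewrite subr_gt0 => /(_ Wz).
  apply: filterS => w; rewrite /= ltr_distlC => /andP[+ _].
  by rewrite opprB addrCA subrr addr0.
move=> /nbhs_ballP[e /= e0 eU].
have := lebesgue2_ball z e0; rewrite ltNge => /negP; apply.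
rewrite -N0; apply: le_measure; rewrite ?inE//.
  by apply: measurableX; exact: measurable_ball.
move=> w hw; apply: subN => /=; apply/negP; rewrite -ltNge lte_fin.
by apply: eU.
Qed.
End plane_measure.

(** * Partial derivatives of smooth functions *)

Section smooth_functions.
Context {R : realType} {V W W1 W2 : normedModType R}.

(** Along a line of direction [v] the one-variable and the directional difference quotients are the
    same function, so their limits agree, default values included. *)
Let slice_quotient (f : V -> W) (v : V) (z : R -> V) s :
  (forall h, z (h + s) = h *: v + z s) ->
  (fun h => h^-1 *: (((f \o z) \o shift s) (h *: 1) - (f \o z) s)) =
  (fun h => h^-1 *: ((f \o shift (z s)) (h *: v) - f (z s))).
Proof.
by move=> zh; apply/funext => h /=; rewrite /GRing.scale/= mulr1 zh.
Qed.

Lemma derive_slice (f : V -> W) (v : V) (z : R -> V) s :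
  (forall h, z (h + s) = h *: v + z s) -> 'D_1 (f \o z) s = 'D_v f (z s).
Proof. by move=> zh; rewrite /derive (slice_quotient f zh). Qed.

Lemma derivable_slice (f : V -> W) (v : V) (z : R -> V) s :
  (forall h, z (h + s) = h *: v + z s) -> derivable f (z s) v ->
  derivable (f \o z) s 1.
Proof. by move=> zh; rewrite /derivable (slice_quotient f zh). Qed.

Lemma is_derive_slice (f : V -> W) (v : V) (z : R -> V) s :
  (forall h, z (h + s) = h *: v + z s) -> derivable f (z s) v ->
  is_derive s 1 (f \o z) ('D_v f (z s)).
Proof.
move=> zh df; apply: DeriveDef; first exact: derivable_slice df.
exact: derive_slice.
Qed.

Lemma is_derive_fst (g : V -> W1 * W2) x v d : is_derive x v g d ->
  is_derive x v (fun z => (g z).1) d.1.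
Proof.
move=> [dg <-].
have h : h^-1 *: (((g \o shift x) (h *: v)).1 - (g x).1) @[h --> 0^'] --> ('D_v g x).1.
  exact: (cvg_comp _ fst dg cvg_fst).
by apply: DeriveDef; [apply/cvg_ex; eexists; exact: h|exact: cvg_lim h].
Qed.

Lemma is_derive_snd (g : V -> W1 * W2) x v d : is_derive x v g d ->
  is_derive x v (fun z => (g z).2) d.2.
Proof.
move=> [dg <-].
have h : h^-1 *: (((g \o shift x) (h *: v)).2 - (g x).2) @[h --> 0^'] --> ('D_v g x).2.
  exact: (cvg_comp _ snd dg cvg_snd).
by apply: DeriveDef; [apply/cvg_ex; eexists; exact: h|exact: cvg_lim h].
Qed.

Lemma smooth_fst (g : V -> W1 * W2) : smooth g -> smooth (fun z => (g z).1).
Proof.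
move=> sg n; move: (sg n); elim: n g {sg} => [|n ih] g /= [cg dg].
  by split => //; exact: cont_fst.
split=> [|v]; first exact: cont_fst.
have [dgv cgv] := dg v.
have dfst x : is_derive x v (fun z => (g z).1) ('D_v g x).1.
  by apply: is_derive_fst; apply: DeriveDef.
split=> [x|]; first by case: (dfst x).
rewrite (_ : 'D_v _ = fun x => ('D_v g x).1); first exact: ih.
by apply/funext => x; have [_ ->] := dfst x.
Qed.

Lemma smooth_snd (g : V -> W1 * W2) : smooth g -> smooth (fun z => (g z).2).
Proof.
move=> sg n; move: (sg n); elim: n g {sg} => [|n ih] g /= [cg dg].
  by split => //; exact: cont_snd.
split=> [|v]; first exact: cont_snd.
have [dgv cgv] := dg v.
have dsnd x : is_derive x v (fun z => (g z).2) ('D_v g x).2.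
  by apply: is_derive_snd; apply: DeriveDef.
split=> [x|]; first by case: (dsnd x).
rewrite (_ : 'D_v _ = fun x => ('D_v g x).2); first exact: ih.
by apply/funext => x; have [_ ->] := dsnd x.
Qed.

Lemma smooth_continuous (f : V -> W) : smooth f -> continuous f.
Proof. by move=> /(_ 0%N)[]. Qed.

Lemma smooth_derivable (f : V -> W) v x : smooth f -> derivable f x v.
Proof. by move=> /(_ 1%N)[_ /(_ v)[]]. Qed.

Lemma smooth_derive (f : V -> W) v : smooth f -> smooth ('D_v f).
Proof. by move=> sf n; have [_ /(_ v)[]] := sf n.+1. Qed.
End smooth_functions.

Section spacetime.
Context {R : realType}.
Local Notation V := (R * (R * R))%type.
Definition et : V := (1, (0, 0)).
Definition ex : V := (0, (1, 0)).
Definition ey : V := (0, (0, 1)).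
Variables (f : V -> R).
Hypothesis sf : smooth f.

Lemma smooth_cont3 : continuous (fun z : R * (R * R) => f (z.1, (z.2.1, z.2.2))).
Proof.
have cf := smooth_continuous sf.
by rewrite (_ : (fun _ => _) = f)//; apply/funext => -[? []].
Qed.

Lemma is_derive_et (t x y : R) :
  is_derive t 1 (fun t => f (t, (x, y))) ('D_et f (t, (x, y))).
Proof.
apply: (@is_derive_slice R V R f et (fun t => (t, (x, y)))).
  move=> h; rewrite /et; congr (_, (_, _)) => /=.
  - by rewrite /GRing.scale/= mulr1.
  - by rewrite /GRing.scale/= mulr0 add0r.
  - by rewrite /GRing.scale/= mulr0 add0r.
exact: smooth_derivable.
Qed.

Lemma is_derive_ex (t x y : R) :
  is_derive x 1 (fun x => f (t, (x, y))) ('D_ex f (t, (x, y))).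
Proof.
apply: (@is_derive_slice R V R f ex (fun x => (t, (x, y)))).
  move=> h; rewrite /ex; congr (_, (_, _)) => /=.
  - by rewrite /GRing.scale/= mulr0 add0r.
  - by rewrite /GRing.scale/= mulr1.
  - by rewrite /GRing.scale/= mulr0 add0r.
exact: smooth_derivable.
Qed.

Lemma is_derive_ey (t x y : R) :
  is_derive y 1 (fun y => f (t, (x, y))) ('D_ey f (t, (x, y))).
Proof.
apply: (@is_derive_slice R V R f ey (fun y => (t, (x, y)))).
  move=> h; rewrite /ey; congr (_, (_, _)) => /=.
  - by rewrite /GRing.scale/= mulr0 add0r.
  - by rewrite /GRing.scale/= mulr0 add0r.
  - by rewrite /GRing.scale/= mulr1.
exact: smooth_derivable.
Qed.
End spacetime.

(** * The equation and the initial conditions in coordinates *)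

Section equation.
Context {R : realType}.
Local Notation V := (R * (R * R))%type.

Lemma derive_frozen_time (f : V -> R) (w : R * R) t :
  'D_w (fun x => f (t, x)) = fun x => 'D_((0, w) : V) f (t, x).
Proof.
apply/funext => x; rewrite /derive; congr (lim (_ @ 0^')).
apply/funext => h /=; rewrite (_ : h *: ((0, w) : V) + (t, x) = (t, h *: w + x))//.
by congr (_, _); rewrite /= scaler0 add0r.
Qed.

Lemma derive_fst (g : V -> R * R) v x : smooth g ->
  ('D_v g x).1 = 'D_v (fun z => (g z).1) x.
Proof.
move=> sg; have h : is_derive x v g ('D_v g x).
  by apply: DeriveDef => //; exact: smooth_derivable.
by have [_ ->] := is_derive_fst h.
Qed.

Lemma derive_snd (g : V -> R * R) v x : smooth g ->
  ('D_v g x).2 = 'D_v (fun z => (g z).2) x.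
Proof.
move=> sg; have h : is_derive x v g ('D_v g x).
  by apply: DeriveDef => //; exact: smooth_derivable.
by have [_ ->] := is_derive_snd h.
Qed.

Variables (a b : R) (u0 u1 : R * R -> R * R) (u : R -> R * R -> R * R) (g : V -> R * R).
Hypotheses (sg : smooth g) (ug : forall t x, 0 <= t -> u t x = g (t, x))
  (sol : elastic_wave_solution a b u0 u1 u).

Let p (z : V) := (g z).1.
Let q (z : V) := (g z).2.
Let sp : smooth p := smooth_fst sg.
Let sq : smooth q := smooth_snd sg.

(** [u] and [g] agree for nonnegative times only; around a positive time the first derivatives then
    agree on a neighbourhood, hence the second ones too. *)
Let utt t x : 0 < t -> derive1n 2 (fun s => u s x) t = 'D_et ('D_et g) (t, x).
Proof.
have zh (s h : R) : (h + s, x) = h *: et + (s, x) :> V.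
  rewrite /et; congr (_, _) => /=; first by rewrite /GRing.scale/= mulr1.
  by rewrite (_ : (0, 0) = 0) ?scaler0 ?add0r.
have ut (s : R) : 0 < s -> derive1 (fun s => u s x) s = 'D_et g (s, x).
  move=> s0; rewrite derive1E -(derive_slice (z := fun s => (s, x)) g (zh s)).
  apply: near_eq_derive; near=> r.
  by rewrite /= ug//; apply: ltW; near: r; exact: lt_nbhsr.
move=> t0; rewrite /derive1n/= derive1E.
rewrite -(derive_slice (z := fun s => (s, x)) _ (zh t)).
apply: near_eq_derive; near=> r; rewrite /=; apply: ut.
by near: r; exact: lt_nbhsr.
Unshelve. all: by end_near. Qed.

Let u_frozen t : 0 <= t -> u t = fun x => g (t, x).
Proof. by move=> t0; apply/funext => x; exact: ug. Qed.

Let lap (f : V -> R) t x : laplacian (fun y => f (t, y)) x =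
  'D_ex ('D_ex f) (t, x) + 'D_ey ('D_ey f) (t, x).
Proof.
pose e1 := etrans (congr1 (fun F : R * R -> R => 'D_((1, 0) : R * R) F) (derive_frozen_time f (1, 0) t))
  (derive_frozen_time ('D_ex f) (1, 0) t).
pose e2 := etrans (congr1 (fun F : R * R -> R => 'D_((0, 1) : R * R) F) (derive_frozen_time f (0, 1) t))
  (derive_frozen_time ('D_ey f) (0, 1) t).
exact: (f_equal2 +%R (congr1 (@^~ x) e1) (congr1 (@^~ x) e2)).
Qed.

Let grad_div t x : grad (div (fun y => g (t, y))) x =
  ('D_ex ('D_ex p) (t, x) + 'D_ex ('D_ey q) (t, x),
   'D_ey ('D_ex p) (t, x) + 'D_ey ('D_ey q) (t, x)).
Proof.
have -> : div (fun y => g (t, y)) = fun y => ('D_ex p \+ 'D_ey q) (t, y).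
  apply/funext => y.
  exact: (f_equal2 +%R (congr1 (@^~ y) (derive_frozen_time p (1, 0) t))
                       (congr1 (@^~ y) (derive_frozen_time q (0, 1) t))).
pose F := 'D_ex p \+ 'D_ey q.
have -> : grad (fun y => F (t, y)) x = ('D_ex F (t, x), 'D_ey F (t, x)).
  exact: (f_equal2 pair (congr1 (@^~ x) (derive_frozen_time F (1, 0) t))
                        (congr1 (@^~ x) (derive_frozen_time F (0, 1) t))).
have sx := smooth_derive ex sp; have sy := smooth_derive ey sq.
by rewrite /F; congr (_, _); rewrite deriveD//; exact: smooth_derivable.
Qed.

Lemma wave_equation t x : 0 < t ->
  'D_et ('D_et p) (t, x) =
    a ^+ 2 * ('D_ex ('D_ex p) (t, x) + 'D_ey ('D_ey p) (t, x)) +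
    (b ^+ 2 - a ^+ 2) * ('D_ex ('D_ex p) (t, x) + 'D_ex ('D_ey q) (t, x)) /\
  'D_et ('D_et q) (t, x) =
    a ^+ 2 * ('D_ex ('D_ex q) (t, x) + 'D_ey ('D_ey q) (t, x)) +
    (b ^+ 2 - a ^+ 2) * ('D_ey ('D_ex p) (t, x) + 'D_ey ('D_ey q) (t, x)).
Proof.
move=> t0; have := ews_equation sol x t0.
rewrite utt// (u_frozen (ltW t0)) grad_div /vlaplacian (lap p) (lap q).
have e1 : ('D_et ('D_et g) (t, x)).1 = 'D_et ('D_et p) (t, x).
  rewrite (derive_fst _ _ (smooth_derive et sg)); congr ('D_et _ _).
  by apply/funext => z; exact: derive_fst.
have e2 : ('D_et ('D_et g) (t, x)).2 = 'D_et ('D_et q) (t, x).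
  rewrite (derive_snd _ _ (smooth_derive et sg)); congr ('D_et _ _).
  by apply/funext => z; exact: derive_snd.
move=> h; split.
  have := congr1 fst h; rewrite /= e1 => /eqP.
  by rewrite -addrA -opprD subr_eq0 => /eqP.
have := congr1 snd h; rewrite /= e2 => /eqP.
by rewrite -addrA -opprD subr_eq0 => /eqP.
Qed.

Lemma initial_position x : g (0, x) = u0 x.
Proof. by rewrite -ug// (ews_position sol). Qed.

(** The two-sided time derivative of [g] at 0 is also the limit from the right, where [g] is [u];
    uniqueness of limits identifies it with [u1]. *)
Lemma initial_velocity x : 'D_et p (0, x) = (u1 x).1 /\ 'D_et q (0, x) = (u1 x).2.
Proof.
have zh (h : R) : (h + 0, x) = h *: et + (0, x) :> V.
  rewrite /et; congr (_, _) => /=; first by rewrite /GRing.scale/= mulr1.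
  by rewrite (_ : (0, 0) = 0) ?scaler0 ?add0r.
have dg : derivable g (0, x) et by exact: smooth_derivable.
suff <- : 'D_et g (0, x) = u1 x by split; rewrite ?derive_fst ?derive_snd.
have h : h^-1 *: (u h x - u 0 x) @[h --> 0^'+] --> 'D_et g (0, x).
  have : h^-1 *: ((g \o shift (0, x)) (h *: et) - g (0, x)) @[h --> 0^'+] --> 'D_et g (0, x).
    apply: cvg_dnbhs_at_right; exact: dg.
  apply: cvg_trans; apply: near_eq_cvg; near=> h.
  rewrite ug//= ug ?zh//= -?zh ?addr0//.
have vel := @ews_velocity _ _ _ _ _ _ sol x.
exact: (cvg_unique _ h vel).
Unshelve. all: by end_near. Qed.
End equation.

(** * Norms of the data as iterated integrals *)

Section norms.
Context {R : realType}.
Implicit Types (w : R * R -> R * R).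

Lemma enorm_ge0 (x : R * R) : 0 <= enorm x. Proof. exact: sqrtr_ge0. Qed.

Lemma sqr_enorm (x : R * R) : enorm x ^+ 2 = x.1 ^+ 2 + x.2 ^+ 2.
Proof. by rewrite sqr_sqrtr// addr_ge0// sqr_ge0. Qed.

Lemma enorm0 : enorm (0 : R * R) = 0.
Proof. by rewrite /enorm/= expr0n/= addr0 sqrtr0. Qed.

Lemma normr_fst_le (x : R * R) : `|x.1| <= enorm x.
Proof. by rewrite -sqrtr_sqr ler_wsqrtr// lerDl sqr_ge0. Qed.

Lemma normr_snd_le (x : R * R) : `|x.2| <= enorm x.
Proof. by rewrite -sqrtr_sqr ler_wsqrtr// lerDr sqr_ge0. Qed.

Lemma cont_enorm w : continuous w -> continuous (fun x => enorm (w x)).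
Proof.
move=> cw; have c2 : continuous (fun x => (w x).1 ^+ 2 + (w x).2 ^+ 2).
  by apply: contD; apply: contX; [exact: cont_fst|exact: cont_snd].
exact: (cont_comp1 (@sqrt_continuous R) c2).
Qed.

Lemma supp_eq0 w L (x : R * R) : supp w `<=` [set x | enorm x <= L] ->
  L < enorm x -> w x = 0.
Proof.
move=> sw Lx; apply/eqP; apply: contraTT Lx => wx; rewrite -leNgt.
by apply: sw; exact: subset_closure.
Qed.

Variables (w : R * R -> R * R) (L : R).
Hypotheses (cw : continuous w) (w0 : forall x, L < enorm x -> w x = 0).

Let w_box (x y : R) : L < `|x| \/ L < `|y| -> w (x, y) = 0.
Proof.
move=> h; apply: w0; case: h => h; apply: (lt_le_trans h).
  exact: (normr_fst_le (x, y)).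
exact: (normr_snd_le (x, y)).
Qed.

Lemma vLnorm1E : vLnorm 1%:E w =
  (boxint (- L) L (- L) L (fun x y => enorm (w (x, y))))%:E.
Proof.
rewrite /vLnorm unlock invr1 poweRe1; last first.
  by apply: integral_ge0 => x _; exact: poweR_ge0.
rewrite -(integral_boxint (f := fun z => enorm (w z))).
- by apply: eq_integral => z _; rewrite poweRe1// gee0_abs// lee_fin enorm_ge0.
- exact: cont_enorm.
- by move=> z; exact: enorm_ge0.
- by move=> x y /w_box ->; exact: enorm0.
Qed.

Lemma integral_sqr_enorm : (\int[lebesgue2]_z (enorm (w z) ^+ 2)%:E)%E =
  (boxint (- L) L (- L) L (fun x y => (w (x, y)).1 ^+ 2 + (w (x, y)).2 ^+ 2))%:E.
Proof.
rewrite (integral_boxint (f := fun z => enorm (w z) ^+ 2) (rho := L)).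
- by congr (_%:E); apply: eq_boxint => x y _ _; exact: sqr_enorm.
- by apply: contX; exact: cont_enorm.
- by move=> z; exact: sqr_ge0.
- by move=> x y /w_box ->; rewrite enorm0 expr0n.
Qed.

Lemma sqr_vLnorm2E : (vLnorm 2%:E w ^+ 2)%E =
  (boxint (- L) L (- L) L (fun x y => (w (x, y)).1 ^+ 2 + (w (x, y)).2 ^+ 2))%:E.
Proof.
rewrite /vLnorm unlock.
have -> : (\int[lebesgue2]_z `|(enorm (w z))%:E| `^ 2)%E =
          (\int[lebesgue2]_z (enorm (w z) ^+ 2)%:E)%E.
  by apply: eq_integral => z _; rewrite /= ger0_norm ?enorm_ge0// powR_mulrn// enorm_ge0.
rewrite integral_sqr_enorm poweR_EFin powR12_sqrt; last first.
  by apply: boxint_ge0 => x y _ _; rewrite addr_ge0// sqr_ge0.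
rewrite -EFin_expe sqr_sqrtr//.
by apply: boxint_ge0 => x y _ _; rewrite addr_ge0// sqr_ge0.
Qed.

Lemma enorm_le_vLnormy W : (vLnorm +oo w <= W%:E)%E -> forall x, enorm (w x) <= W.
Proof.
(* The norm with exponent [+oo] is the essential supremum when the whole space has positive measure;
   the plane contains a square of positive measure. *)
rewrite /vLnorm unlock ifT; last first.
  apply: lt_le_trans (lebesgue2_ball (0, 0) ltr01) _.
  apply: le_measure; rewrite ?inE//=.
  by apply: measurableX; exact: measurable_ball.
rewrite (_ : abse \o _ = fun x => (enorm (w x))%:E).
  exact: ess_sup_le (cont_enorm cw).
by apply/funext => z /=; rewrite ger0_norm// enorm_ge0.
Qed.
End norms.

(** After exponentiation: [2 * L + 1 + c * t] is at most [(2 * L + 1 + c) * t], hence at most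
    [L * (b * t) ^+ 2] beyond the threshold. A linear function is compared with the square of
    another, whence the factor 2, whatever the speed [c]. *)
Lemma ln_support_le (R : realType) (b c L t : R) : 0 < b -> 0 < c -> 0 < L -> 1 <= t ->
  (2 * L + 1 + c) / (L * b ^+ 2) <= t -> 
  ln (2 * L + 1 + c * t) - ln L <= 2 * ln (2 * L + b * t).
Proof.
move=> b0 c0 L0 t1; have t0 : 0 < t by exact: lt_le_trans t1.
have b2 : 0 < L * b ^+ 2 by rewrite mulr_gt0// exprn_gt0.
rewrite ler_pdivrMr// => h.
have bt : 0 < 2 * L + b * t by rewrite addr_gt0// mulr_gt0.
have r0 : 0 < 2 * L + 1 + c * t by rewrite !addr_gt0// mulr_gt0.
rewrite -ln_div ?posrE// [2 * ln _]mulr_natl -lnXn// ler_ln ?posrE ?divr_gt0// ?exprn_gt0//.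
rewrite ler_pdivrMr//.
apply: (@le_trans _ _ ((2 * L + 1 + c) * t)).
  by rewrite [leRHS]mulrDl lerD2r ler_peMr// addr_ge0// mulr_ge0// ltW.
apply: (@le_trans _ _ (t * (L * b ^+ 2) * t)); first by rewrite ler_pM2r.
rewrite (_ : t * (L * b ^+ 2) * t = (b * t) ^+ 2 * L); last by ring.
rewrite ler_pM2r// ler_pXn2r// ?nnegrE ?mulr_ge0 ?ltW//.
by rewrite ltrDr mulr_gt0.
Qed.

Theorem theorem1p2 (R : realType) (a b L : R)
    (a_gt0 : 0 < a) (lt_ab : a < b) (L_gt0 : 0 < L) :
  exists2 C : R, 0 < C &
    forall (u0 u1 : R * R -> R * R) (u : R -> R * R -> R * R),
      test_function u0 -> test_function u1 ->
      supp u0 `|` supp u1 `<=` [set x | enorm x <= L] ->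
      elastic_wave_solution a b u0 u1 u ->
      \forall t \near +oo,
        (\int[lebesgue2]_x ((enorm (u t x)) ^+ 2)%:E <=
          C%:E * (vLnorm 2%:E u0 ^+ 2 + vLnorm +oo u1 ^+ 2
                  + vLnorm 1%:E u1 ^+ 2 * (ln (2 * L + b * t))%:E))%E.
Proof.
have b_gt0 : 0 < b := lt_trans a_gt0 lt_ab.
have m_ge0 : 0 <= b ^+ 2 - a ^+ 2.
  by rewrite subr_ge0 ler_pXn2r ?nnegrE ?ltW.
have a2 : 0 < a ^+ 2 by rewrite exprn_gt0.
(* A speed above both [a ^+ 2 + m = b ^+ 2] and 1, as the flux bounds require. *)
pose c := b ^+ 2 + 1.
have c_ge : a ^+ 2 + (b ^+ 2 - a ^+ 2) <= c by rewrite addrCA subrr addr0 lerDl.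
have c_ge1 : 1 <= c by rewrite lerDr sqr_ge0.
have c_gt0 : 0 < c := lt_le_trans ltr01 c_ge1.
(* [C1] and [8 / a ^+ 2] come from [box_estimate]: the constants of the Poincare inequality for
   [e = a ^+ 2 / 4], times 2 for the two components and 2 for the halves in the energy. [C2] is
   doubled once more by [ln_support_le]. *)
pose C1 := 384 * L ^+ 4 / a ^+ 2; pose C2 := 16 / a ^+ 2.
have C1_ge0 : 0 <= C1.
  apply: divr_ge0; last exact: ltW.
  by apply: mulr_ge0; [exact: ler0n|exact/exprn_ge0/ltW].
have C2_ge0 : 0 <= C2 by apply: divr_ge0; [exact: ler0n|exact: ltW].
exists (1 + C1 + C2); first by rewrite -addrA ltr_pwDl// addr_ge0.
move=> u0 u1 u [su0 _] [su1 _] suppL sol.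
have [g sg ug0] := ews_smooth sol.
have ug t x : 0 <= t -> u t x = g (t, x).
  by move=> t0; apply: (ug0 (t, x)); rewrite inE.
have cu0 := smooth_continuous su0; have cu1 := smooth_continuous su1.
have out0 x : L < enorm x -> u0 x = 0.
  by apply: supp_eq0 => y hy; apply: suppL; left.
have out1 x : L < enorm x -> u1 x = 0.
  by apply: supp_eq0 => y hy; apply: suppL; right.
pose p z := (g z).1; pose q z := (g z).2.
have sp : smooth p := smooth_fst sg.
have sq : smooth q := smooth_snd sg.
near=> t.
have t1 : 1 <= t by near: t; apply: nbhs_pinfty_ge; exact: num_real.
(* This gives [1 <= b * t], so that the logarithm is nonnegative. *)
have tb : b^-1 <= t by near: t; apply: nbhs_pinfty_ge; exact: num_real.
have tK : (2 * L + 1 + c) / (L * b ^+ 2) <= t by near: t; apply: nbhs_pinfty_ge; exact: num_real.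
have t0 : 0 <= t := le_trans ler01 t1.
set l := ln (2 * L + b * t).
have l_ge0 : 0 <= l.
  apply: ln_ge0; apply: (@le_trans _ _ (b * t)).
    by rewrite -(mulfV (lt0r_neq0 b_gt0)) ler_pM2l.
  by rewrite lerDr mulr_ge0// ltW.
pose cur (f : R * (R * R) -> R) s x y := f (s, (x, y)).
have spt := smooth_derive et sp; have sqt := smooth_derive et sq.
have spx := smooth_derive ex sp; have sqx := smooth_derive ex sq.
have spy := smooth_derive ey sp; have sqy := smooth_derive ey sq.
have spxx := smooth_derive ex spx; have sqxx := smooth_derive ex sqx.
have spxy := smooth_derive ey spx; have sqyx := smooth_derive ex sqy.
have spyy := smooth_derive ey spy; have sqyy := smooth_derive ey sqy.
have pos0 x y : cur p 0 x y = (u0 (x, y)).1 /\ cur q 0 x y = (u0 (x, y)).2.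
  by rewrite /cur /p /q (initial_position ug sol).
have vel0 x y : cur ('D_et p) 0 x y = (u1 (x, y)).1 /\
    cur ('D_et q) 0 x y = (u1 (x, y)).2 := initial_velocity sg ug sol (x, y).
have far x y : L < `|x| \/ L < `|y| -> L < enorm (x, y).
  case=> h; apply: (lt_le_trans h).
    exact: (normr_fst_le (x, y)).
  exact: (normr_snd_le (x, y)).
have data0 x y : L < `|x| \/ L < `|y| -> cur p 0 x y = 0 /\ cur q 0 x y = 0.
  by move=> /far h; have [-> ->] := pos0 x y; rewrite out0.
have data1 x y : L < `|x| \/ L < `|y| ->
    cur ('D_et p) 0 x y = 0 /\ cur ('D_et q) 0 x y = 0.
  by move=> /far h; have [-> ->] := vel0 x y; rewrite out1.
have pde1 (s x y : R) : 0 < s -> is_derive s 1 (fun s => cur ('D_et p) s x y)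
    (a ^+ 2 * (cur ('D_ex ('D_ex p)) s x y + cur ('D_ey ('D_ey p)) s x y) +
     (b ^+ 2 - a ^+ 2) * (cur ('D_ex ('D_ex p)) s x y + cur ('D_ex ('D_ey q)) s x y)).
  move=> s0; have [e _] := wave_equation sg ug sol (x, y) s0.
  exact: der_eq (is_derive_et spt s x y) e.
have pde2 (s x y : R) : 0 < s -> is_derive s 1 (fun s => cur ('D_et q) s x y)
    (a ^+ 2 * (cur ('D_ex ('D_ex q)) s x y + cur ('D_ey ('D_ey q)) s x y) +
     (b ^+ 2 - a ^+ 2) * (cur ('D_ey ('D_ex p)) s x y + cur ('D_ey ('D_ey q)) s x y)).
  move=> s0; have [_ e] := wave_equation sg ug sol (x, y) s0.
  exact: der_eq (is_derive_et sqt s x y) e.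
pose rho := 2 * L + 1 + c * t.
have ct0 : 0 <= c * t by rewrite mulr_ge0// ltW.
have rho_ge0 : 0 <= rho by rewrite /rho !addr_ge0// mulr_ge0// ltW.
have rho_ge : 2 * L <= rho by rewrite /rho -addrA lerDl addr_ge0.
have rho_gt : L + c * t < rho.
  by rewrite /rho ltrD2r (mulr_natl L 2) mulr2n -addrA ltrDl addr_gt0.
have u_out x y : rho < `|x| \/ rho < `|y| -> u t (x, y) = 0.
  move=> h.
  have [] := @finite_speed R a (b ^+ 2 - a ^+ 2) c L (cur p) (cur q) _ _ _ _ _ _
    _ _ _ _ _ _ m_ge0 c_ge c_ge1
    (smooth_cont3 sp) (smooth_cont3 sq) (smooth_cont3 spt) (smooth_cont3 sqt)
    (smooth_cont3 spx) (smooth_cont3 spy) (smooth_cont3 sqx) (smooth_cont3 sqy)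
    (smooth_cont3 spxx) (smooth_cont3 spxy) (smooth_cont3 spyy)
    (smooth_cont3 sqxx) (smooth_cont3 sqyx) (smooth_cont3 sqyy)
    (is_derive_et sp) (is_derive_et sq) (is_derive_ex sp) (is_derive_ex sq)
    (is_derive_ey sp) (is_derive_ey sq) (is_derive_ex spx) (is_derive_ey spx)
    (is_derive_ey spy) (is_derive_ex sqx) (is_derive_ex sqy) (is_derive_ey sqy)
    pde1 pde2 data0 data1 t x y t0.
    by case: h => h; [left|right]; exact: lt_trans h.
  by move=> p0 q0; rewrite ug// [g _]surjective_pairing -[LHS]/(cur p t x y, cur q t x y) p0 q0.
(* Stated for any real bound [W] of the initial velocity, because its sup norm is an extended
   real. *)
have estimate W : (forall x, enorm (u1 x) <= W) ->
  (\int[lebesgue2]_x ((enorm (u t x)) ^+ 2)%:E <=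
    (boxint (- L) L (- L) L (fun x y => (u0 (x, y)).1 ^+ 2 + (u0 (x, y)).2 ^+ 2) +
    C1 * W ^+ 2 + C2 * (boxint (- L) L (- L) L (fun x y => enorm (u1 (x, y))) ^+ 2 * l))%:E)%E.
  move=> uW.
  have cut : continuous (u t).
    rewrite (_ : u t = fun x => g (t, x)); last by apply/funext => x; exact: ug.
    exact: cont_comp (cont_pair (@cont_cst _ _ t) (@cont_id _)) (smooth_continuous sg).
  rewrite (integral_boxint (f := fun z => enorm (u t z) ^+ 2) (rho := rho)); first last.
  - by move=> x y /u_out ->; rewrite enorm0 expr0n.
  - by move=> z; exact: sqr_ge0.
  - by apply: contX; exact: cont_enorm.
  rewrite lee_fin.
  have cw : continuous (fun z : R * R => enorm (u1 (z.1, z.2))).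
    by apply: cont_enorm; apply: cont_comp cu1; cont.
  have uw x y : `|cur ('D_et p) 0 x y| <= enorm (u1 (x, y)) /\
      `|cur ('D_et q) 0 x y| <= enorm (u1 (x, y)).
    have [-> ->] := vel0 x y.
    by split; [exact: normr_fst_le|exact: normr_snd_le].
  have uwW x y : 0 <= enorm (u1 (x, y)) <= W by rewrite enorm_ge0 uW.
  have := @box_estimate R a (b ^+ 2 - a ^+ 2) c L (cur p) (cur q) _ _ _ _ _ _
    _ _ _ _ _ _ a_gt0 m_ge0 c_ge c_ge1 L_gt0
    (smooth_cont3 sp) (smooth_cont3 sq) (smooth_cont3 spt) (smooth_cont3 sqt)
    (smooth_cont3 spx) (smooth_cont3 spy) (smooth_cont3 sqx) (smooth_cont3 sqy)
    (smooth_cont3 spxx) (smooth_cont3 spxy) (smooth_cont3 spyy)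
    (smooth_cont3 sqxx) (smooth_cont3 sqyx) (smooth_cont3 sqyy)
    (is_derive_et sp) (is_derive_et sq) (is_derive_ex sp) (is_derive_ex sq)
    (is_derive_ey sp) (is_derive_ey sq) (is_derive_ex spx) (is_derive_ey spx)
    (is_derive_ey spy) (is_derive_ex sqx) (is_derive_ex sqy) (is_derive_ey sqy)
    pde1 pde2 data0 data1 t rho (fun x y => enorm (u1 (x, y))) W
    t0 rho_ge rho_gt cw uw uwW.
  have -> : boxint (- rho) rho (- rho) rho (fun x y => cur p t x y ^+ 2 + cur q t x y ^+ 2) =
      boxint (- rho) rho (- rho) rho (fun x y => enorm (u t (x, y)) ^+ 2).
    by apply: eq_boxint => x y _ _; rewrite sqr_enorm ug.
  have -> : boxint (- rho) rho (- rho) rho (fun x y => cur p 0 x y ^+ 2 + cur q 0 x y ^+ 2) =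
      boxint (- L) L (- L) L (fun x y => (u0 (x, y)).1 ^+ 2 + (u0 (x, y)).2 ^+ 2).
    have Lr : L <= rho by apply: le_trans rho_ge; rewrite ler_peMl ?ler1n// ltW.
    rewrite (boxint_support Lr).
      by apply: eq_boxint => x y _ _; have [-> ->] := pos0 x y.
    by move=> x y /data0[-> ->]; rewrite expr0n addr0.
  move=> h; apply: le_trans h _; rewrite -/C1; apply: lerD => //.
  rewrite (_ : C2 = 8 / a ^+ 2 * 2); last by rewrite /C2 mulrAC -natrM.
  rewrite -[leRHS]mulrA; apply: ler_wpM2l; first by apply: divr_ge0; [exact: ler0n|exact: ltW].
  rewrite [leRHS]mulrCA; apply: ler_wpM2l; first exact: sqr_ge0.
  exact: ln_support_le.
have V0 : (0 <= vLnorm +oo u1)%E by exact: Lnorm_ge0.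
rewrite (sqr_vLnorm2E cu0 out0) (vLnorm1E cu1 out1).
set D := boxint _ _ _ _ _; set M := boxint _ _ _ _ _.
(* A real norm is taken as [W]; the value [+oo] makes the right-hand side infinite, and [-oo]
   contradicts [V0]. *)
case: (vLnorm +oo u1) (@enorm_le_vLnormy R u1 cu1) V0 => [W| |//] uW V0.
  apply: le_trans (estimate W (uW W (lexx _))) _.
  rewrite -!EFin_expe -EFinM lee_fin -/D -/M.
  have D0 : 0 <= D by apply: boxint_ge0 => x y _ _; rewrite addr_ge0// sqr_ge0.
  have X0 : 0 <= M ^+ 2 * l by rewrite mulr_ge0// sqr_ge0.
  have W0 : 0 <= W ^+ 2 by exact: sqr_ge0.
  rewrite -subr_ge0.
  rewrite (_ : _ - _ = (C1 + C2) * D + (1 + C2) * W ^+ 2 + (1 + C1) * (M ^+ 2 * l)); last by ring.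
  by rewrite !addr_ge0// mulr_ge0// addr_ge0.
rewrite (_ : (_ * _)%E = +oo%E) ?leey//.
rewrite expe2 mulyy -EFin_expe -EFinM addey// addye// gt0_muley// lte_fin.
by rewrite -addrA ltr_pwDl// addr_ge0.
Unshelve. all: by end_near. Qed.
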